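(* Let $\mathbb D=\{z\in\mathbb C:|z|<1\}$, and let $\lambda:\partial\mathbb D\to\mathbb C$ with $|\lambda(\zeta)|=1$ for all $\zeta\in\partial\mathbb D$, and $\varphi:\partial\mathbb D\to\mathbb R$ be Lebesgue measurable functions. Then there exists an analytic function $f:\mathbb D\to\mathbb C$ such that for almost every $\zeta\in\partial\mathbb D$ (with respect to arc length), $$\lim_{z\to\zeta}\ \mathrm{Re}\,\{\overline{\lambda(\zeta)}\cdot f(z)\}=\varphi(\zeta)$$ as $z\to\zeta$ along any nontangential path in $\mathbb D$ ending at $\zeta$.
   Context: A nontangential path in $\mathbb D$ ending at $\zeta\in\partial\mathbb D$ is a path in $\mathbb D$ tending to $\zeta$ and lying in some angular sector (Stolz angle) $\{z\in\mathbb D: |\arg(1-\bar\zeta z)|<\theta\}$ with $\theta<\pi/2$, near $\zeta$. *)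

(* Defs.v *)
From HB Require Import structures.
From mathcomp Require Import all_boot all_order all_algebra.
From mathcomp Require Import all_classical all_reals all_analysis.
From mathcomp Require Import measurable_realfun.
From mathcomp.real_closed Require Import complex.
Set Implicit Arguments. Unset Strict Implicit. Unset Printing Implicit Defensive.
Import Order.TTheory GRing.Theory Num.Theory.
Import numFieldNormedType.Exports.
Local Open Scope classical_set_scope.
Local Open Scope ring_scope.

Definition expi (R : realType) (t : R) : R[i] := Complex (cos t) (sin t).

(* Lebesgue measurable sets of R: Borel set union a Lebesgue-null set
   (the completion of the Lebesgue measure, as in the library). *)
Definition lebesgue_measurable_set (R : realType) (A : set R) : Prop :=
  completed_algebra_gen (@lebesgue_measure R) A.

Definition lebesgue_measurable_fun (R : realType) (D : set R) (g : R -> R) : Prop :=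
  forall B : set R, measurable B -> lebesgue_measurable_set (D `&` g @^-1` B).

Definition circle_measurable_real (R : realType) (u : R[i] -> R) : Prop :=
  lebesgue_measurable_fun `[0, pi *+ 2[ (fun t => u (expi t)).

Definition circle_measurable_complex (R : realType) (u : R[i] -> R[i]) : Prop :=
  circle_measurable_real (fun z => complex.Re (u z)) /\
  circle_measurable_real (fun z => complex.Im (u z)).

Definition analytic_on_disc (R : realType) (f : R[i] -> R[i]) : Prop :=
  forall z : R[i], `|z| < 1 -> derivable (f : (R[i])^o -> (R[i])^o) z 1.

(* principal argument of w, for Re w > 0 *)
Definition arg_rhp (R : realType) (w : R[i]) : R :=
  atan (complex.Im w / complex.Re w).

(* A nontangential path in D ending at zeta: a continuous map
   g : [0,1) -> D with g t -> zeta as t -> 1^-, and lying, for t close to 1,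
   in a Stolz angle { z in D : |arg (1 - conj(zeta) z)| < theta },
   theta < pi/2. (For z in D, Re (1 - conj(zeta) z) > 0, so arg is the
   arctangent of Im/Re.) *)
Definition nontangential_path (R : realType) (zeta : R[i]) (g : R -> R[i]) : Prop :=
  {within `[0, 1[, continuous (g : R -> (R[i])^o)} /\
  (forall t : R, 0 <= t < 1 -> `|g t| < 1) /\
  ((g : R -> (R[i])^o) t @[t --> 1^'-] --> (zeta : (R[i])^o)) /\
  exists theta : R, theta < pi / 2 /\
    exists t0 : R, t0 < 1 /\
      forall t : R, t0 <= t < 1 ->
        0 < complex.Re (1 - zeta^* * g t) /\
        `|arg_rhp (1 - zeta^* * g t)| < theta.

(* Main.v *)
(** Luzin's trick replaces boundary value theory. The function is [f = \sum_n f_n], where [f_n] reduces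
    the boundary residual [phi - Re (conj lam * S_n)] of the partial sum [S_n] outside a set of measure
    [2^-n], while [|f_n| <= 2^-n] on the whole Stolz domain of every vertex where the residual was
    already tiny; by Borel-Cantelli the series then converges uniformly on Stolz domains at almost
    every vertex, and its limit can be computed termwise.

    On an arc where [phi] and [lam] are nearly constants [c] and [l], the block is
    [c * l * kern (r * conj p * W z)] with [kern u = - 2 u / (1 - u)] and [W] a high power of a map of
    the disc into itself, of modulus near 1 on the arc and bounded away from 1 on Stolz domains with
    vertex off the arc. Since [Re (kern u) = 1 - (1 - |u|^2) / |1 - u|^2], the block has real part close
    to [c] (after removing [l]) wherever [W] stays away from [p] on the arc, it is bounded by
    [2 |c| / (1 - r)] on the disc, and it is negligible away from the arc. *)
Require Import Defs.
From HB Require Import structures.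
From mathcomp Require Import all_boot all_order all_algebra.
From mathcomp Require Import all_classical all_reals all_analysis.
From mathcomp Require Import measurable_realfun ring lra.
From mathcomp.real_closed Require Import complex.
Import Order.TTheory GRing.Theory Num.Theory.
Import numFieldNormedType.Exports.
Local Open Scope classical_set_scope.
Set Implicit Arguments. Unset Strict Implicit. Unset Printing Implicit Defensive.
Local Open Scope ring_scope.

(** The residual of [S_n] has to be continuous on the next Lusin set, so every block is
    differentiable on the closed disc: the self-map of the disc is sampled on a slightly smaller
    disc, and [r < 1] keeps the pole of [kern] away. The obstacle is that on the circle
    [1 - Re (kern u)] is a Poisson kernel, small only where [u] is far from 1, while nothing tells
    which unimodular values [W] comes close to. This is why a phase [p] is left free: among about
    [2^n] separated phases, one is approached by [W] only on a set of measure of order [2^-n], with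
    separation of order [2^-n].

    Two demands then compete for [1 - r]. Accuracy at the vertex wants [1 - r] small; smallness of
    the block on the Stolz domains of its own arc wants it large compared with [|c|]. The separation
    allows [1 - r] of order [4^-n] for small [c], and the block is then of size [2^-n] if the
    residual was at most a small constant times [8^-n]. This is the tolerance handed from stage to
    stage. A vertex whose residual is still large receives a large block, which is harmless when it
    happens finitely often. *)

Local Notation cnorm := (@Normc.normc _).
Local Notation Re := complex.Re.
Local Notation Im := complex.Im.

Ltac pos := repeat first
  [ assumption | by rewrite ?ltr0n ?ler0n | exact: sqr_ge0 | exact: normr_ge0
  | apply: divr_gt0 | apply: mulr_gt0 | rewrite invr_gt0 | apply: exprn_gt0
  | apply: addr_gt0 | apply: divr_ge0 | apply: mulr_ge0 | rewrite invr_ge0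
  | apply: exprn_ge0 | apply: addr_ge0 | apply: ltW ].


(** * Real part, imaginary part and real-valued modulus *)

Section ComplexModulus.
Variable R : realType.
Implicit Types (x y : R) (z u v : R[i]).
Local Notation "x %:C" := (real_complex R x) (format "x %:C").

Lemma cReD u v : Re (u + v) = Re u + Re v.
Proof. by case: u; case: v. Qed.

Lemma cReN u : Re (- u) = - Re u.
Proof. by case: u. Qed.

Lemma cReB u v : Re (u - v) = Re u - Re v.
Proof. by rewrite cReD cReN. Qed.

Lemma cImD u v : Im (u + v) = Im u + Im v.
Proof. by case: u; case: v. Qed.

Lemma cImN u : Im (- u) = - Im u.
Proof. by case: u. Qed.

Lemma cImB u v : Im (u - v) = Im u - Im v.
Proof. by rewrite cImD cImN. Qed.

Lemma cReM u v : Re (u * v) = Re u * Re v - Im u * Im v.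
Proof. by case: u; case: v. Qed.

Lemma cImM u v : Im (u * v) = Re u * Im v + Im u * Re v.
Proof. by case: u => a b; case: v => c d. Qed.

Lemma complex_eqP u v : Re u = Re v -> Im u = Im v -> u = v.
Proof. by case: u => a b; case: v => c d /= -> ->. Qed.

Lemma normE z : `|z| = (cnorm z)%:C.
Proof. by []. Qed.

Lemma cnorm_sqr z : cnorm z ^+ 2 = Re z ^+ 2 + Im z ^+ 2.
Proof. by case: z => a b /=; rewrite sqr_sqrtr// addr_ge0// sqr_ge0. Qed.

Lemma cnorm_ge0 z : 0 <= cnorm z.
Proof. by case: z => a b; exact: sqrtr_ge0. Qed.

Lemma cnorm0 : cnorm (0 : R[i]) = 0.
Proof. exact: Normc.normc0. Qed.

Lemma cnorm1 : cnorm (1 : R[i]) = 1.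
Proof. exact: Normc.normc1. Qed.

Lemma cnormM u v : cnorm (u * v) = cnorm u * cnorm v.
Proof. exact: Normc.normcM. Qed.

Lemma cnormV u : cnorm u^-1 = (cnorm u)^-1.
Proof. exact: Normc.normcV. Qed.

Lemma cnorm_eq0 z : (cnorm z == 0) = (z == 0).
Proof.
apply/eqP/eqP => [|->]; [exact: Normc.eq0_normc|exact: cnorm0].
Qed.

Lemma cnorm_gt0 z : (0 < cnorm z) = (z != 0).
Proof. by rewrite lt_def cnorm_eq0 cnorm_ge0 andbT. Qed.

Lemma cnormX z n : cnorm (z ^+ n) = cnorm z ^+ n.
Proof. by elim: n => [|n IH]; rewrite ?expr0 ?cnorm1// !exprS cnormM IH. Qed.

Lemma cnormD u v : cnorm (u + v) <= cnorm u + cnorm v.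
Proof. exact: le_normcD. Qed.

Lemma cnormN u : cnorm (- u) = cnorm u.
Proof. exact: normcN. Qed.

Lemma cnormB u v : cnorm (u - v) <= cnorm u + cnorm v.
Proof. by rewrite -(cnormN v) cnormD. Qed.

Lemma cdistC u v : cnorm (u - v) = cnorm (v - u).
Proof. by rewrite -cnormN opprB. Qed.

Lemma cdistB u v : cnorm u - cnorm v <= cnorm (u - v).
Proof. by rewrite lerBlDr -{1}(subrK v u) cnormD. Qed.

Lemma cdist_triangle v u z : cnorm (u - z) <= cnorm (u - v) + cnorm (v - z).
Proof. by rewrite -{1}(subrK v u) -addrA cnormD. Qed.

Lemma cnorm_sum (I : Type) (r : seq I) (P : pred I) (F : I -> R[i]) :
  cnorm (\sum_(i <- r | P i) F i) <= \sum_(i <- r | P i) cnorm (F i).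
Proof.
elim/big_rec2: _ => [|i a b _ h]; first by rewrite cnorm0.
by rewrite (le_trans (cnormD _ _))// lerD2l.
Qed.

Lemma cnorm_real x : cnorm x%:C = `|x|.
Proof. by rewrite /= expr0n addr0 sqrtr_sqr. Qed.

Lemma cnorm_conj z : cnorm (conjc z) = cnorm z.
Proof. by case: z => a b /=; rewrite sqrrN. Qed.

Lemma normr_Re z : `|Re z| <= cnorm z.
Proof.
rewrite -(ler_pXn2r (n := 2))// ?nnegrE ?cnorm_ge0//.
by rewrite cnorm_sqr -normrX ger0_norm ?sqr_ge0// lerDl sqr_ge0.
Qed.

Lemma normr_Im z : `|Im z| <= cnorm z.
Proof.
rewrite -(ler_pXn2r (n := 2))// ?nnegrE ?cnorm_ge0//.
by rewrite cnorm_sqr -normrX ger0_norm ?sqr_ge0// lerDr sqr_ge0.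
Qed.

Lemma Re_le_cnorm z : Re z <= cnorm z.
Proof. exact: le_trans (ler_norm _) (normr_Re z). Qed.

Lemma cnorm_le_ReIm z : cnorm z <= `|Re z| + `|Im z|.
Proof.
rewrite -(ler_pXn2r (n := 2))// ?nnegrE ?cnorm_ge0// ?addr_ge0//.
rewrite cnorm_sqr sqrrD -!normrX !(ger0_norm (sqr_ge0 _)).
by rewrite lerD2r lerDl mulrn_wge0// mulr_ge0.
Qed.

Lemma conjM_cnorm1 z : cnorm z = 1 -> conjc z * z = 1.
Proof.
move=> z1; have := cnorm_sqr z; rewrite z1 expr1n => h.
by apply: complex_eqP; case: z z1 h => a b _ /= h; rewrite ?h ?expr2; lra.
Qed.

Lemma cnorm_expi x : cnorm (expi x) = 1.
Proof. by rewrite /= cos2Dsin2 sqrtr1. Qed.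

End ComplexModulus.

(** * Complex differentiability at a point *)

Section ComplexDerivability.
Variable R : realType.
Local Notation C := (R[i]).
Implicit Types (f g : C -> C) (z : C).

(** Derivability over the field [R[i]] is complex differentiability. Asked at every point of the
    closed disc, it concerns full neighbourhoods of the boundary points, so that boundary values are
    continuous. *)
Definition hol f z := derivable (f : C^o -> C^o) z 1.

(** Balls of [R[i]] have radii in [R[i]], and a positive complex number is real; this translates
    between such radii and radii in [R]. *)
Lemma nbhs_complexP (P : C -> Prop) z :
  (\forall u \near (z : C^o), P u) <->
  exists2 e : R, 0 < e & forall u, cnorm (u - z) < e -> P u.
Proof.
split.
  move=> /nbhs_ballP[e /= e0 he].
  move: e0; rewrite ltcE /= => /andP[/eqP ei er].
  exists (Re e) => // u hu; apply: he; rewrite /ball /= normE -cnormN opprB.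
  by rewrite ltcE /= ei eqxx.
move=> [e e0 he]; apply/nbhs_ballP; exists (real_complex R e) => /=.
  by rewrite ltcE /= eqxx.
move=> u; rewrite /ball /= normE -cnormN opprB ltcE /= eqxx /= => hu.
exact: he.
Qed.

Lemma cvg_complexP (T : Type) (F : set_system T) (FF : Filter F) (f : T -> C) l :
  (f : T -> C^o) x @[x --> F] --> (l : C^o) <->
  forall e : R, 0 < e -> \forall x \near F, cnorm (f x - l) < e.
Proof.
split => [h e e0|h].
  have : \forall u \near (l : C^o), cnorm (u - l) < e.
    by apply/nbhs_complexP; exists e.
  exact: h.
move=> A /nbhs_complexP[e e0 he]; apply: filterS (h e e0) => x.
exact: he.
Qed.

Lemma hol_cst (c : C) z : hol (fun=> c) z.
Proof. exact: derivable_cst. Qed.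

Lemma hol_id z : hol id z.
Proof. exact: derivable_id. Qed.

Lemma holD f g z : hol f z -> hol g z -> hol (fun u => f u + g u) z.
Proof. exact: derivableD. Qed.

Lemma holB f g z : hol f z -> hol g z -> hol (fun u => f u - g u) z.
Proof. exact: derivableB. Qed.

Lemma holM f g z : hol f z -> hol g z -> hol (fun u => f u * g u) z.
Proof. exact: (@derivableM C C^o). Qed.

Lemma holV f z : f z != 0 -> hol f z -> hol (fun u => (f u)^-1) z.
Proof. exact: (@derivableV C C^o). Qed.

Lemma holX f n z : hol f z -> hol (fun u => f u ^+ n) z.
Proof.
move=> hf; elim: n => [|n IH]; first exact: hol_cst.
have -> : (fun u => f u ^+ n.+1) = (fun u => f u * f u ^+ n).
  by apply/funext => u; rewrite exprS.
exact: holM.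
Qed.

Lemma hol_sum (I : Type) (r : seq I) (F : I -> C -> C) z :
  (forall i, hol (F i) z) -> hol (fun u => \sum_(i <- r) F i u) z.
Proof.
move=> hF; elim: r => [|i r IH].
  have -> : (fun u => \sum_(j <- [::]) F j u) = (fun=> 0).
    by apply/funext => u; rewrite big_nil.
  exact: hol_cst.
have -> : (fun u => \sum_(j <- i :: r) F j u) = (fun u => F i u + \sum_(j <- r) F j u).
  by apply/funext => u; rewrite big_cons.
exact: (holD (hF i) IH).
Qed.

Lemma hol_comp f g z : hol f z -> hol g (f z) -> hol (g \o f) z.
Proof.
move=> /derivable1_diffP hf /derivable1_diffP hg.
by apply/derivable1_diffP; exact: (differentiable_comp hf hg).
Qed.

Lemma hol_cont f z : hol f z ->
  forall e : R, 0 < e -> exists2 d : R, 0 < d &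
    forall u, cnorm (u - z) < d -> cnorm (f u - f z) < e.
Proof.
move=> /derivable1_diffP/differentiable_continuous h e e0.
have /cvg_complexP/(_ e e0)/nbhs_complexP[d d0 hd] := h.
by exists d.
Qed.

End ComplexDerivability.

(** * Differentiability of the principal square root *)

Section SquareRoot.
Variable R : realType.
Implicit Types (z u : R[i]).

Lemma hol_of_quotient (f : R[i] -> R[i]) z (a : R[i]) :
  (forall e : R, 0 < e -> exists2 d : R, 0 < d & forall u, u != z ->
     cnorm (u - z) < d -> cnorm ((f u - f z) / (u - z) - a) < e) ->
  hol f z.
Proof.
move=> H; apply/cvg_ex; exists (a : R[i]^o).
apply/cvg_complexP => e e0; have [d d0 hd] := H e e0.
have : \forall h \near (0 : R[i]^o), cnorm (h - 0) < d.
  by apply/nbhs_complexP; exists d.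
rewrite /dnbhs /within /=; apply: filterS => h; rewrite subr0 => hlt h0.
have hz : (h + z) - z = h by rewrite addrK.
have hz' : h + z != z by rewrite -subr_eq0 hz.
have := hd (h + z) hz'; rewrite hz => /(_ hlt).
by rewrite [h *: _]mulr1 [_ *: _]mulrC.
Qed.

Lemma Re_sqrtc_ge0 z : 0 <= Re (sqrtc z).
Proof. by case: z => a b /=; rewrite sqrtr_ge0. Qed.

(** Since [sqrtc] always has nonnegative real part, [sqrtc u + sqrtc z] has modulus at least [p] for
    every [u], even across the branch cut. Factoring [u - z] through the roots then gives the
    derivative with an explicit error, without prior continuity. *)
Lemma hol_sqrtc z : 0 < Re (sqrtc z) -> hol (@sqrtc R) z.
Proof.
set p := Re _ => p0; apply: (hol_of_quotient (a := (sqrtc z + sqrtc z)^-1)).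
move=> e e0; exists (e * p ^+ 3); first by rewrite mulr_gt0// exprn_gt0.
move=> u uz hu.
have lb v : p <= cnorm (sqrtc v + sqrtc z).
  by rewrite (le_trans _ (Re_le_cnorm _))// cReD lerDr Re_sqrtc_ge0.
have gt0 v : 0 < cnorm (sqrtc v + sqrtc z) by exact: lt_le_trans (lb v).
have ne0 v : sqrtc v + sqrtc z != 0 by rewrite -cnorm_gt0.
have E : u - z = (sqrtc u - sqrtc z) * (sqrtc u + sqrtc z).
  by rewrite -subr_sqr !sqr_sqrtc.
have d0 : sqrtc u - sqrtc z != 0.
  by apply: contraNneq uz => d0; rewrite -subr_eq0 E d0 mul0r.
have -> : (sqrtc u - sqrtc z) / (u - z) - (sqrtc z + sqrtc z)^-1 =
    - ((u - z) / ((sqrtc u + sqrtc z) ^+ 2 * (sqrtc z + sqrtc z))).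
  rewrite E; field; rewrite ?d0 ?ne0 //=.
rewrite cnormN cnormM cnormV ltr_pdivrMr ?cnorm_gt0 ?mulf_neq0 ?expf_neq0//.
apply: (lt_le_trans hu); rewrite ler_pM2l// cnormM cnormX exprSr.
by apply: ler_pM; rewrite ?exprn_ge0 ?(ltW p0)// lerXn2r// nnegrE ltW.
Qed.

End SquareRoot.

(** * A self-map of the disc that is unimodular on an arc around 1 *)

Section ArcFunction.
Variable R : realType.
Implicit Types (x y p q : R) (z u : R[i]).
Local Notation "x %:C" := (real_complex R x) (format "x %:C").

(** Here [p + iq] is a square root of [1 + (x + iy)^2]. Eliminating [q] gives the identity [E],
    which forces [x <= p]; the second bound is [0 <= q ^+ 2]. *)
Lemma sqrt_real_part_lb x y p q : 0 < x -> 0 <= p ->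
  p ^+ 2 - q ^+ 2 = 1 + x ^+ 2 - y ^+ 2 -> p * q = x * y ->
  x <= p /\ 1 - y ^+ 2 <= p ^+ 2.
Proof.
move=> x0 p0 h1 h2.
have E : (p ^+ 2 - x ^+ 2) * (p ^+ 2 + y ^+ 2) = p ^+ 2.
  have h3 : p ^+ 2 * q ^+ 2 = x ^+ 2 * y ^+ 2 by rewrite -!exprMn h2.
  have hq : q ^+ 2 = p ^+ 2 - (1 + x ^+ 2 - y ^+ 2) by lra.
  rewrite hq in h3.
  by move: h3; lra.
have px : x <= p.
  rewrite leNgt; apply/negP => px.
  have h : p ^+ 2 - x ^+ 2 < 0 by rewrite subr_lt0 ltrXn2r// nnegrE ltW.
  have := sqr_ge0 p; rewrite -E nmulr_rge0// => h'.
  have := sqr_ge0 y; have := sqr_ge0 p => a b.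
  have p2 : p ^+ 2 = 0 by lra.
  have y2 : y ^+ 2 = 0 by lra.
  by have := sqr_ge0 q; have := sqr_ge0 x; lra.
split => //.
have : (p ^+ 2 - x ^+ 2) * (p ^+ 2 + y ^+ 2) <= p ^+ 2 by rewrite E.
have := sqr_ge0 q; have := sqr_ge0 x; lra.
Qed.

(** The conformal map of the disc onto the right half-plane sending 1 to infinity: an arc of the
    circle around 1 becomes a neighbourhood of infinity on the imaginary axis. *)
Definition cayley z := (1 + z) / (1 - z).

Lemma Re_cayley z : z != 1 -> Re (cayley z) = (1 - cnorm z ^+ 2) / cnorm (1 - z) ^+ 2.
Proof.
rewrite eq_sym -subr_eq0 => z1.
have : cayley z * (1 - z) = 1 + z by rewrite mulfVK.
have : cnorm (1 - z) ^+ 2 != 0 by rewrite sqrf_eq0 cnorm_eq0.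
rewrite !cnorm_sqr; move: (cayley z); case: z z1 => a b z1 [x y] /= ne /eqP.
rewrite eq_complex /= => /andP[/eqP h1 /eqP h2].
apply: (mulIf ne); rewrite mulfVK//.
have -> : 1 - (a ^+ 2 + b ^+ 2) = (1 + a) * (1 - a) + b * (0 - b) by ring.
have -> : b * (0 - b) = (0 + b) * (0 - b) by ring.
by rewrite -h1 -h2; ring.
Qed.

Lemma cdist_cayley z u : z != 1 -> u != 1 ->
  cnorm (cayley z - cayley u) = 2 * cnorm (z - u) / (cnorm (1 - z) * cnorm (1 - u)).
Proof.
rewrite ![_ == 1]eq_sym -![1 == _]subr_eq0 => z1 u1.
have -> : cayley z - cayley u = 2%:R%:C * (z - u) / ((1 - z) * (1 - u)).
  by rewrite /cayley rmorph_nat; field; rewrite z1 u1.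
by rewrite !cnormM cnormV cnormM cnorm_real ger0_norm.
Qed.

Variable T : R.
Hypothesis T0 : 0 < T.

(* On the unit circle [cayley] is imaginary, so [root_fun] is imaginary, and [lens_fun] unimodular,
   exactly on the arc [1 < T * |Im (cayley z)|] around 1; inside the disc the real part of [root_fun]
   is at least that of [T * cayley z], a Poisson kernel, hence positive. *)
Definition root_fun z := sqrtc (1 + (T%:C * cayley z) ^+ 2).
Local Notation s := root_fun.

Definition lens_fun z := (s z - 1) / (s z + 1).
Local Notation w := lens_fun.

Lemma root_fun_sqr z : s z ^+ 2 = 1 + (T%:C * cayley z) ^+ 2.
Proof. exact: sqr_sqrtc. Qed.

Lemma ltn1_neq1 z : cnorm z < 1 -> z != 1.
Proof. by apply: contraTneq => ->; rewrite cnorm1 ltxx. Qed.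

Lemma Re_cayley_gt0 z : cnorm z < 1 -> 0 < Re (cayley z).
Proof.
move=> z1; rewrite Re_cayley ?ltn1_neq1// divr_gt0//.
  by rewrite subr_gt0 expr_lt1// cnorm_ge0.
by rewrite exprn_gt0// cnorm_gt0 subr_eq0 eq_sym ltn1_neq1.
Qed.

Lemma root_fun_lb z : cnorm z < 1 ->
  T * Re (cayley z) <= Re (s z) /\ 1 - (T * Im (cayley z)) ^+ 2 <= Re (s z) ^+ 2.
Proof.
move=> z1; apply: (@sqrt_real_part_lb _ _ _ (Im (s z))).
- by rewrite mulr_gt0// Re_cayley_gt0.
- exact: Re_sqrtc_ge0.
- have := congr1 (@complex.Re R) (root_fun_sqr z).
  by rewrite [s z ^+ 2]expr2 [(_ * cayley z) ^+ 2]expr2 cReD !cReM !cImM /=; lra.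
- have := congr1 (@complex.Im R) (root_fun_sqr z).
  by rewrite [s z ^+ 2]expr2 [(_ * cayley z) ^+ 2]expr2 cImD !cImM !cReM !cImM /=; lra.
Qed.

Lemma Re_root_fun_gt0 z : cnorm z < 1 -> 0 < Re (s z).
Proof.
by move=> z1; apply: lt_le_trans (root_fun_lb z1).1; rewrite mulr_gt0// Re_cayley_gt0.
Qed.

Lemma root_funD1_ge1 z : 1 <= cnorm (s z + 1).
Proof. by apply: le_trans (Re_le_cnorm _); rewrite cReD lerDr Re_sqrtc_ge0. Qed.

Lemma root_funD1_neq0 z : s z + 1 != 0.
Proof. by rewrite -cnorm_gt0 (lt_le_trans _ (root_funD1_ge1 z)). Qed.

(** Both estimates of [w] are read off here: a lower bound on [Re (s z)] with an upper bound on
    [s z] keeps [w z] inside the circle, and a small [Re (s z) / |s z|^2] pushes it to the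
    circle. *)
Lemma lens_fun_defect z : 1 - cnorm (w z) ^+ 2 = 4 * Re (s z) / cnorm (s z + 1) ^+ 2.
Proof.
have ne : cnorm (s z + 1) ^+ 2 != 0 by rewrite sqrf_eq0 cnorm_eq0 root_funD1_neq0.
apply: (mulIf ne); rewrite mulfVK// cnormM cnormV exprMn exprVn mulrBl mulfVK//.
by rewrite !cnorm_sqr cReB cImB cReD cImD /=; ring.
Qed.

Lemma lens_fun_lt1 z : cnorm z < 1 -> cnorm (w z) < 1.
Proof.
move=> z1; rewrite -(@expr_lt1 _ 2)// ?cnorm_ge0// -subr_gt0 lens_fun_defect.
rewrite divr_gt0 ?mulr_gt0 ?Re_root_fun_gt0//.
all: by rewrite cnorm_gt0 root_funD1_neq0.
Qed.

Lemma hol_lens_fun z : cnorm z < 1 -> hol w z.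
Proof.
move=> z1; have hs : hol s z.
  apply: (@hol_comp _ (fun u => 1 + (T%:C * cayley u) ^+ 2) (@sqrtc R)); last first.
    by apply: hol_sqrtc; exact: Re_root_fun_gt0.
  apply: holD; first exact: hol_cst.
  apply: holX; apply: holM; first exact: hol_cst.
  apply: holM; first by apply: holD; [exact: hol_cst|exact: hol_id].
  apply: holV; last by apply: holB; [exact: hol_cst|exact: hol_id].
  by rewrite subr_eq0 eq_sym ltn1_neq1.
apply: holM; first by apply: holB; [exact: hs|exact: hol_cst].
by apply: holV; [exact: root_funD1_neq0|apply: holD; [exact: hs|exact: hol_cst]].
Qed.

(** On a smaller disc [Re (s z)] is at least some [p0 > 0], so [s z - s u] is controlled by the
    difference of the squares divided by [s z + s u], that is, by [cayley z - cayley u]. *)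
Lemma lens_fun_lipschitz (r : R) : 0 <= r < 1 -> exists2 L, 0 <= L &
  forall z u, cnorm z <= r -> cnorm u <= r -> cnorm (w z - w u) <= L * cnorm (z - u).
Proof.
move=> /andP[r0 r1].
pose d := 1 - r; have d0 : 0 < d by rewrite subr_gt0.
have lt1 z : cnorm z <= r -> cnorm z < 1 by move/le_lt_trans; apply.
have dist1 z : cnorm z <= r -> d <= cnorm (1 - z).
  by move=> zr; apply: le_trans (cdistB _ _); rewrite cnorm1 /d; lra.
have cay_le z : cnorm z <= r -> cnorm (cayley z) <= 2 / d.
  move=> zr; rewrite cnormM cnormV ler_pM ?invr_ge0 ?cnorm_ge0//.
    by rewrite (le_trans (cnormD _ _))// cnorm1; lra.
  by rewrite lef_pV2 ?posrE ?dist1// (lt_le_trans d0) ?dist1.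
pose p0 := T * (d / 4).
have p00 : 0 < p0 by rewrite mulr_gt0// divr_gt0.
have Re_ge z : cnorm z <= r -> p0 <= Re (s z).
  move=> zr; apply: le_trans (root_fun_lb (lt1 z zr)).1; rewrite ler_pM2l//.
  have z0 := cnorm_ge0 z; have dz := dist1 z zr.
  rewrite Re_cayley ?ltn1_neq1 ?lt1// ler_pM ?invr_ge0 ?sqr_ge0 ?(ltW d0)//.
    by rewrite /d; nra.
  rewrite lef_pV2 ?posrE ?exprn_gt0//; last by rewrite (lt_le_trans d0).
  have : cnorm (1 - z) <= 2 by rewrite (le_trans (cnormB _ _))// cnorm1; lra.
  by have := cnorm_ge0 (1 - z); nra.
have s_lip z u : cnorm z <= r -> cnorm u <= r ->
    cnorm (s z - s u) <= T ^+ 2 * (4 / d) * (2 / d ^+ 2) / p0 * cnorm (z - u).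
  move=> zr ur.
  have E : (s z - s u) * (s z + s u) =
      (T ^+ 2)%:C * (cayley z - cayley u) * (cayley z + cayley u).
    rewrite -subr_sqr !root_fun_sqr rmorphXn /=; ring.
  have h1 : p0 <= cnorm (s z + s u).
    apply: le_trans (Re_le_cnorm _); rewrite cReD.
    by have := Re_ge z zr; have := Re_ge u ur; lra.
  have h2 : cnorm (s z - s u) * p0 <= T ^+ 2 * cnorm (cayley z - cayley u) * (4 / d).
    apply: le_trans (ler_wpM2l (cnorm_ge0 _) h1) _.
    rewrite -cnormM E !cnormM cnorm_real ger0_norm ?sqr_ge0//.
    rewrite ler_wpM2l//; first by rewrite mulr_ge0 ?sqr_ge0 ?cnorm_ge0.
    rewrite (le_trans (cnormD _ _))//.
    by have := cay_le z zr; have := cay_le u ur; lra.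
  have h3 : cnorm (cayley z - cayley u) <= 2 / d ^+ 2 * cnorm (z - u).
    rewrite cdist_cayley ?ltn1_neq1 ?lt1// -mulrAC ler_wpM2r ?cnorm_ge0//.
    rewrite ler_wpM2l// lef_pV2 ?posrE ?exprn_gt0//; last first.
      by rewrite mulr_gt0// (lt_le_trans d0) ?dist1.
    by rewrite expr2 ler_pM ?(ltW d0) ?dist1.
  rewrite mulrAC ler_pdivlMr// (le_trans h2)//.
  rewrite [leRHS](_ : _ = T ^+ 2 * (2 / d ^+ 2 * cnorm (z - u)) * (4 / d)); last by ring.
  by rewrite ler_wpM2r ?divr_ge0 ?(ltW d0)// ler_wpM2l ?sqr_ge0.
exists (2 * (T ^+ 2 * (4 / d) * (2 / d ^+ 2) / p0)).
  by rewrite !mulr_ge0 ?invr_ge0 ?mulr_ge0 ?sqr_ge0 ?(ltW d0) ?(ltW p00)// ?(ltW T0).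
move=> z u zr ur.
have -> : w z - w u = 2%:R%:C * (s z - s u) / ((s z + 1) * (s u + 1)).
  by rewrite /lens_fun rmorph_nat; field; rewrite !root_funD1_neq0.
rewrite !cnormM cnormV cnormM cnorm_real ger0_norm// -[leLHS]mulrA -[leRHS]mulrA ler_wpM2l//.
rewrite (le_trans _ (s_lip z u zr ur))// ler_piMr ?cnorm_ge0// invf_le1.
  by rewrite -[1]mulr1 ler_pM// root_funD1_ge1.
by rewrite mulr_gt0// (lt_le_trans ltr01) ?root_funD1_ge1.
Qed.

(** The condition on [c] says that [T * |cayley zeta| < 1] at the vertices considered. The bound on
    [z - zeta] makes [|cayley z - cayley zeta|] at most a multiple of [Re (cayley z)], hence of
    [Re (s z)]. If [Re (s z)] were tiny, [T * |Im (cayley z)|] would stay below 1, and the second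
    bound of [root_fun_lb] would make [Re (s z)] large after all. *)
Lemma lens_fun_nontangential (c A : R) : c < 1 -> 0 < A -> T ^+ 2 * (1 + c) < 1 - c ->
  exists2 q, 0 <= q < 1 & forall zeta z, cnorm zeta = 1 -> Re zeta <= c ->
    cnorm z < 1 -> cnorm (z - zeta) <= A * (1 - cnorm z ^+ 2) -> cnorm (w z) <= q.
Proof.
move=> c1 A0 hc.
pose d := Num.sqrt (2 * (1 - c)).
have d0 : 0 < d by rewrite sqrtr_gt0 mulr_gt0// subr_gt0.
have d2 : d ^+ 2 = 2 * (1 - c) by rewrite sqr_sqrtr// mulr_ge0// subr_ge0 ltW.
(* The maximum with 0 covers [c < -1], where the quotient is negative. *)
pose m := Num.max 0 (T ^+ 2 * (1 + c) / (1 - c)).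
have m0 : 0 <= m by rewrite le_max lexx.
have m1 : m < 1 by rewrite gt_max ltr01 ltr_pdivrMr ?subr_gt0// mul1r.
pose th := Num.sqrt m; have th0 : 0 <= th by rewrite sqrtr_ge0.
have th2 : th ^+ 2 = m by rewrite sqr_sqrtr.
have th1 : th < 1 by rewrite -(@expr_lt1 _ 2)// th2.
pose B := 4 * A / d; have B0 : 0 < B by rewrite divr_gt0// mulr_gt0.
(* Chosen so that [Re (s z) < p0] would give [th + B * Re (s z) + Re (s z) < 1], contradicting [1 <=
   (T * Im (cayley z)) ^+ 2 + Re (s z) ^+ 2]. *)
pose p0 := (1 - th) / (B + 1).
have p00 : 0 < p0 by rewrite divr_gt0 ?subr_gt0// addr_gt0.
pose S := 2 + (T * (2 * (1 + 2 * A) / d)) ^+ 2.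
have S0 : 2 <= S by rewrite lerDl sqr_ge0.
pose k := 4 * p0 / (S + 1) ^+ 2.
have Sp : 0 < S + 1 by lra.
have k0 : 0 < k by rewrite /k; pos.
have main zeta z : cnorm zeta = 1 -> Re zeta <= c -> cnorm z < 1 ->
    cnorm (z - zeta) <= A * (1 - cnorm z ^+ 2) -> cnorm (w z) ^+ 2 <= 1 - k.
  move=> zeta1 zetac z1 hz.
  have hzeta : d <= cnorm (1 - zeta).
    rewrite -(@ler_pXn2r _ 2)// ?nnegrE ?cnorm_ge0 ?(ltW d0)// d2 cnorm_sqr.
    have := cnorm_sqr zeta; rewrite zeta1 cReB cImB /= => h; lra.
  have zeta1' : 0 < cnorm (1 - zeta) by exact: lt_le_trans hzeta.
  have zetan : zeta != 1.
    by apply: contraTneq hzeta => ->; rewrite subrr cnorm0 -ltNge.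
  have zn := ltn1_neq1 z1; have z0 := cnorm_ge0 z.
  have z1' : 0 < cnorm (1 - z) by rewrite cnorm_gt0 subr_eq0 eq_sym.
  have hx := Re_cayley zn.
  have z1a : 1 - cnorm z <= cnorm (1 - z).
    by apply: le_trans (cdistB _ _); rewrite cnorm1.
  have z1b : cnorm (1 - z) <= 2 by rewrite (le_trans (cnormB _ _))// cnorm1; lra.
  have hy : T * `|Im (cayley z)| <= th + B * (T * Re (cayley z)).
    have e0 : Re (cayley zeta) = 0.
      by rewrite Re_cayley// zeta1 expr1n subrr mul0r.
    have e1 : (T * Im (cayley zeta)) ^+ 2 <= th ^+ 2.
      have -> : (T * Im (cayley zeta)) ^+ 2 = (T * cnorm (cayley zeta)) ^+ 2.
        by rewrite !exprMn [in RHS]cnorm_sqr e0 expr0n add0r.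
      rewrite exprMn /cayley cnormM cnormV expr_div_n th2 /m.
      have u0 : 0 < 1 - Re zeta by lra.
      have -> : cnorm (1 + zeta) ^+ 2 / cnorm (1 - zeta) ^+ 2 =
          (1 + Re zeta) / (1 - Re zeta).
        have hz1 := cnorm_sqr zeta; rewrite zeta1 expr1n in hz1.
        rewrite !cnorm_sqr cReB cReD cImB cImD /=.
        have -> : (1 + Re zeta) ^+ 2 + (0 + Im zeta) ^+ 2 = 2 * (1 + Re zeta) by lra.
        have -> : (1 - Re zeta) ^+ 2 + (0 - Im zeta) ^+ 2 = 2 * (1 - Re zeta) by lra.
        by rewrite -mulf_div divff// mul1r.
      rewrite le_max -mulrA ler_wpM2l ?orbT ?sqr_ge0//.
      by rewrite ler_pdivlMr ?subr_gt0// mulrAC ler_pdivrMr//; nra.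
    have e2 : `|T * Im (cayley zeta)| <= th.
      by rewrite -(@ler_pXn2r _ 2)// ?nnegrE// -normrX ger0_norm ?sqr_ge0.
    have e3 : `|Im (cayley z) - Im (cayley zeta)| <= B * Re (cayley z).
      rewrite -cImB (le_trans (normr_Im _))// cdist_cayley// hx.
      rewrite ler_pdivrMr ?mulr_gt0//.
      have -> : B * ((1 - cnorm z ^+ 2) / cnorm (1 - z) ^+ 2) *
          (cnorm (1 - z) * cnorm (1 - zeta)) =
          2 * (A * (1 - cnorm z ^+ 2)) * (2 / cnorm (1 - z)) * (cnorm (1 - zeta) / d).
        by rewrite /B; field; rewrite !gt_eqF.
      have h0 : 0 <= 2 * cnorm (z - zeta) by rewrite mulr_ge0// cnorm_ge0.
      have hA : 2 * cnorm (z - zeta) <= 2 * (A * (1 - cnorm z ^+ 2)) by rewrite ler_pM2l.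
      apply: (le_trans hA); rewrite -[leRHS]mulrA ler_peMr ?(le_trans h0)//.
      by rewrite -[leLHS]mulr1; apply: ler_pM => //; rewrite ler_pdivlMr// mul1r.
    have -> : T * `|Im (cayley z)| = `|T * Im (cayley z)| by rewrite normrM gtr0_norm.
    have -> : T * Im (cayley z) =
        T * Im (cayley zeta) + T * (Im (cayley z) - Im (cayley zeta)) by ring.
    rewrite (le_trans (ler_normD _ _))// lerD// normrM gtr0_norm// mulrCA.
    by rewrite ler_pM2l.
  have [h1 h2] := root_fun_lb z1.
  have hp : p0 <= Re (s z).
    rewrite leNgt; apply/negP => lt; move: lt.
    rewrite ltr_pdivlMr ?addr_gt0// => lt.
    have x0 : 0 < T * Re (cayley z) by rewrite mulr_gt0// Re_cayley_gt0.
    have y2 : (T * Im (cayley z)) ^+ 2 <= (th + B * Re (s z)) ^+ 2.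
      have -> : (T * Im (cayley z)) ^+ 2 = (T * `|Im (cayley z)|) ^+ 2.
        by rewrite !exprMn -normrX ger0_norm ?sqr_ge0.
      rewrite lerXn2r// ?nnegrE ?mulr_ge0 ?(ltW T0)//.
        by rewrite addr_ge0// mulr_ge0 ?(ltW B0)//; lra.
      by rewrite (le_trans hy)// lerD2l ler_pM2l.
    have h3 : 0 < B * Re (s z) by rewrite mulr_gt0//; lra.
    have P0 : 0 <= Re (s z) by lra.
    have h4 : 0 <= (th + B * Re (s z)) * Re (s z) by rewrite mulr_ge0//; lra.
    have h5 : (th + B * Re (s z) + Re (s z)) ^+ 2 < 1 by rewrite expr_lt1//; lra.
    by move: h5 h2 y2 h4; rewrite sqrrD; lra.
  have hs : cnorm (s z + 1) <= S + 1.
    rewrite (le_trans (cnormD _ _))// cnorm1 lerD2r.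
    have : cnorm (s z) ^+ 2 <= S - 1.
      rewrite -cnormX root_fun_sqr (le_trans (cnormD _ _))// cnorm1 /S cnormX.
      rewrite cnormM cnorm_real (gtr0_norm T0).
      have -> : 2 + (T * (2 * (1 + 2 * A) / d)) ^+ 2 - 1 =
        1 + (T * (2 * (1 + 2 * A) / d)) ^+ 2 by ring.
      have A2 : 0 <= 1 + 2 * A by lra.
      rewrite lerD2l lerXn2r ?nnegrE ?mulr_ge0 ?(ltW T0) ?cnorm_ge0//.
        by rewrite invr_ge0 ltW.
      rewrite ler_pM2l// cnormM cnormV ler_pdivlMr// mulrAC ler_pdivrMr//.
      (* A nontangential [z] with vertex at distance at least [d] from 1 stays away from 1 itself,
         so [cayley z], and with it [s z], is bounded. *)
      have hd : d <= cnorm (1 - z) * (1 + 2 * A).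
        rewrite (le_trans hzeta)// (le_trans (cdist_triangle z _ _))//.
        have h4 : 1 - cnorm z ^+ 2 <= 2 * cnorm (1 - z).
          by have := sqr_ge0 (1 - cnorm z); lra.
        have h5 : A * (1 - cnorm z ^+ 2) <= A * (2 * cnorm (1 - z)) by rewrite ler_pM2l.
        by lra.
      have h4 : cnorm (1 + z) <= 2 by rewrite (le_trans (cnormD _ _))// cnorm1; lra.
      have -> : 2 * (1 + 2 * A) * cnorm (1 - z) = 2 * (cnorm (1 - z) * (1 + 2 * A)) by ring.
      by apply: ler_pM => //; [exact: cnorm_ge0|exact: ltW].
    by have := sqr_ge0 (cnorm (s z) - 1); lra.
  suff : k <= 1 - cnorm (w z) ^+ 2 by lra.
  rewrite lens_fun_defect /k -mulrA -[leRHS]mulrA ler_pM2l//.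
  have g0 := root_funD1_ge1 z.
  apply: ler_pM => //; first exact: ltW.
    by rewrite invr_ge0 sqr_ge0.
  have g1 : 0 < cnorm (s z + 1) by lra.
  by rewrite lef_pV2 ?posrE ?exprn_gt0// lerXn2r// nnegrE ltW.
exists (Num.sqrt (1 - k)).
  by rewrite sqrtr_ge0 -[ltRHS]sqrtr1 ltr_sqrt//; lra.
move=> zeta z zeta1 zetac z1 hz; rewrite -[cnorm _]ger0_norm ?cnorm_ge0//.
by rewrite -sqrtr_sqr ler_wsqrtr// (main zeta).
Qed.

(** The two equations say [(P + iQ)^2 * (D + iE) = D - S + iE], and [u], [v] are the real and
    imaginary parts of the square. From [P^2 * (P^2 - u) = v^2 / 4], bounds [u <= m1] and
    [|v| <= m2] yield [P^2 <= m1 + m2]. *)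
Lemma sqrt_real_part_ub (P Q D E S a D0 : R) :
  0 < D0 -> D0 <= D -> 0 <= S -> D - S <= a ->  0 <= a ->
  (P ^+ 2 - Q ^+ 2) * D - 2 * P * Q * E = D - S ->
  (P ^+ 2 - Q ^+ 2) * E + 2 * P * Q * D = E ->
  P ^+ 2 <= a / D0 + E ^+ 2 / D0 ^+ 2 + `|E| * S / D0 ^+ 2.
Proof.
move=> D00 hD S0 ha a0.
set u := P ^+ 2 - Q ^+ 2; set v := 2 * P * Q => h1 h2.
have N0 : 0 < D ^+ 2 + E ^+ 2 by have := sqr_ge0 E; nra.
have D2 : D0 ^+ 2 <= D ^+ 2 + E ^+ 2 by have := sqr_ge0 E; nra.
have hu : u * (D ^+ 2 + E ^+ 2) = (D - S) * D + E ^+ 2.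
  have -> : u * (D ^+ 2 + E ^+ 2) = (u * D - v * E) * D + (u * E + v * D) * E by ring.
  by rewrite h1 h2 expr2.
have hv : v * (D ^+ 2 + E ^+ 2) = E * S.
  have -> : E * S = (u * E + v * D) * D - (u * D - v * E) * E by rewrite h1 h2; ring.
  by ring.
set m1 := a / D0 + E ^+ 2 / D0 ^+ 2; set m2 := `|E| * S / D0 ^+ 2.
have m10 : 0 <= m1 by rewrite /m1; pos.
have m20 : 0 <= m2 by rewrite /m2; pos.
have um : u <= m1.
  rewrite -(ler_pM2r N0) hu /m1 [leRHS]mulrDl lerD//.
    rewrite mulrAC ler_pdivlMr//.
    have D1 : 0 <= D by lra.
    apply: (@le_trans _ _ (a * (D * D0))); first by rewrite mulrA !ler_wpM2r// ltW.
    rewrite ler_wpM2l// (le_trans (ler_wpM2l D1 hD))// -expr2.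
    by rewrite lerDl sqr_ge0.
  by rewrite mulrAC ler_pdivlMr ?exprn_gt0// ler_wpM2l ?sqr_ge0.
have vm : `|v| <= m2.
  rewrite -(ler_pM2r N0) -{1}(gtr0_norm N0) -normrM hv normrM (ger0_norm S0).
  rewrite /m2 mulrAC ler_pdivlMr ?exprn_gt0// ler_wpM2l ?mulr_ge0//.
have v2 : v ^+ 2 <= m2 ^+ 2.
  by rewrite -[v ^+ 2]ger0_norm ?sqr_ge0// normrX lerXn2r// nnegrE.
have E4 : P ^+ 2 * (P ^+ 2 - u) = v ^+ 2 / 4 by rewrite /u /v; field.
rewrite leNgt; apply/negP => lt.
have := sqr_ge0 v; nra.
Qed.

(** Used with [a] the reciprocal of [cayley z], [k] that of [root_fun z] and [d] the distance of [z]
    to the circle. Near the arc [a] is almost imaginary and shorter than [T], so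
    [k^2 = a^2 / (a^2 + T^2)] is almost a nonpositive real and [Re k] is of order the square root of
    [d]. *)
Lemma Re_root_bound (k a : R[i]) (d D0 : R) : 0 < D0 -> 0 < d -> d <= 1 / 2 ->
  k ^+ 2 * (a ^+ 2 + (T%:C) ^+ 2) = a ^+ 2 -> 0 <= Re a -> Re a <= 2 * d ->
  cnorm a ^+ 2 <= T ^+ 2 - D0 ->
  Re k ^+ 2 <= d * (4 / D0 + 16 * T ^+ 2 / D0 ^+ 2 + 4 * T * T ^+ 2 / D0 ^+ 2).
Proof.
move=> D00 d0 d12 kE al0 al1 a2.
have aI : `|Im a| <= T.
  rewrite -(@ler_pXn2r _ 2)// ?nnegrE ?(ltW T0)// -normrX ger0_norm ?sqr_ge0//.
  by have := cnorm_sqr a; have := sqr_ge0 (Re a); lra.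
have := congr1 (@complex.Im R) kE; have := congr1 (@complex.Re R) kE.
rewrite [k ^+ 2]expr2 [a ^+ 2]expr2 [_%:C ^+ 2]expr2 !(cReM, cReD, cImM, cImD) /= => e1 e2.
pose E := 2 * Re a * Im a.
have hE : `|E| <= 4 * d * T.
  rewrite !normrM (ger0_norm al0) ger0_norm// ler_pM ?mulr_ge0//; lra.
have hE2 : E ^+ 2 <= 16 * T ^+ 2 * d.
  rewrite -[E ^+ 2]ger0_norm ?sqr_ge0// normrX.
  apply: (@le_trans _ _ ((4 * d * T) ^+ 2)).
    by rewrite lerXn2r// nnegrE; pos.
  have -> : (4 * d * T) ^+ 2 = 16 * T ^+ 2 * d * d by ring.
  by rewrite ler_piMr; pos; lra.
have := @sqrt_real_part_ub (Re k) (Im k) (Re a ^+ 2 - Im a ^+ 2 + T ^+ 2) E (T ^+ 2)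
  (Re a ^+ 2) D0 D00.
move=> /(_ _ _ _ _ _ _)/le_trans; apply.
- by have := cnorm_sqr a; have := sqr_ge0 (Re a); lra.
- exact: sqr_ge0.
- by have := sqr_ge0 (Im a); lra.
- exact: sqr_ge0.
- by rewrite /E; lra.
- by rewrite /E; lra.
rewrite !mulrDr; apply: lerD; [apply: lerD|].
- rewrite mulrA ler_pM2r ?invr_gt0//.
  apply: (@le_trans _ _ ((2 * d) ^+ 2)); first by rewrite lerXn2r// nnegrE; pos.
  have -> : (2 * d) ^+ 2 = d * 4 * d by ring.
  by rewrite ler_piMr; pos; lra.
- by rewrite mulrA ler_pM2r ?invr_gt0 ?exprn_gt0//; lra.
- rewrite mulrA ler_pM2r ?invr_gt0 ?exprn_gt0//.
  by rewrite mulrA ler_wpM2r ?sqr_ge0//; lra.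
Qed.

(** This is [|1 - z|^2 / |1 + z|^2 <= (1 - c) / (1 + c) + d] for [z] of modulus [r] in a direction
    of real part [x], with the denominators cleared. *)
Lemma disc_ratio_bound (c x d r : R) : 0 <= c -> c <= x -> 0 <= d -> d <= 1 / 2 ->
  r = 1 - d ->
  (1 + r ^+ 2 - 2 * r * x) * (1 + c) <= (1 - c + d * (1 + c)) * (1 + r ^+ 2 + 2 * r * x).
Proof.
move=> c0 cx d0 d2 ->; rewrite -subr_ge0.
have -> : (1 - c + d * (1 + c)) * (1 + (1 - d) ^+ 2 + 2 * (1 - d) * x) -
    (1 + (1 - d) ^+ 2 - 2 * (1 - d) * x) * (1 + c) =
    4 * ((1 - d) * (x - c)) + 2 * (d * (1 + c) * ((1 - d) * x)) +
    d * (1 + c) * d ^+ 2 + 2 * (d * ((1 - d) + c * (1 - 2 * d))) by ring.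
have : 0 <= x by lra.
have : 0 <= 1 - d by lra.
have : 0 <= 1 + c by lra.
have : 0 <= x - c by lra.
have : 0 <= 1 - 2 * d by lra.
by move=> h1 h2 h3 h4 h5; pos.
Qed.

(** The estimate must be uniform up to the middle of the arc, where [cayley] blows up; hence the
    reciprocals [a] and [k], which stay bounded there. As [|s z| <= |s z + 1|], the defect
    [1 - |w z|^2] is at most [4 * Re k], and [del] makes this at most [1 - eta]. *)
Lemma lens_fun_arc (c eta : R) : 0 <= c < 1 -> 1 - c < T ^+ 2 * (1 + c) -> eta < 1 ->
  exists2 r0, 0 <= r0 < 1 & forall r zeta, r0 <= r < 1 -> cnorm zeta = 1 ->
    c <= Re zeta -> eta <= cnorm (w (r%:C * zeta)).
Proof.
move=> /andP[c0 c1] hc eta1.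
pose D0 := (T ^+ 2 - (1 - c) / (1 + c)) / 2.
have D00 : 0 < D0 by rewrite divr_gt0// subr_gt0 ltr_pdivrMr//; lra.
pose M := 4 / D0 + 16 * T ^+ 2 / D0 ^+ 2 + 4 * T * T ^+ 2 / D0 ^+ 2.
have M0 : 0 < M.
  by rewrite /M; pos.
pose del := Num.min (1 / 2) (Num.min D0 (((1 - eta) / 4) ^+ 2 / M)).
have del0 : 0 < del.
  by rewrite !lt_min D00 !divr_gt0 ?exprn_gt0// divr_gt0// subr_gt0.
exists (1 - del).
  by rewrite subr_ge0 gtrBl del0 andbT ge_min; apply/orP; left; lra.
move=> r zeta /andP[rl r1] zeta1 hz.
pose d := 1 - r.
have d0 : 0 < d by rewrite subr_gt0.
have : d <= del by rewrite /d; lra.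
rewrite !le_min => /and3P[d12 dD dM].
set z := r%:C * zeta.
have r0 : 0 < r by move: d12; rewrite /d; lra.
have zr : cnorm z = r by rewrite cnormM zeta1 cnorm_real gtr0_norm ?mulr1.
have z1 : cnorm z < 1 by rewrite zr.
have zn1 := ltn1_neq1 z1.
have zne : 1 - z != 0 by rewrite subr_eq0 eq_sym.
have Rez : Re z = r * Re zeta by rewrite cReM /= mul0r subr0.
have zp2 : cnorm (1 + z) ^+ 2 = 1 + r ^+ 2 + 2 * r * Re zeta.
  by rewrite -{1}zr !cnorm_sqr cReD cImD Rez /=; ring.
have zm2 : cnorm (1 - z) ^+ 2 = 1 + r ^+ 2 - 2 * r * Re zeta.
  by rewrite -{1}zr !cnorm_sqr cReB cImB Rez /=; ring.
have zp1 : 1 <= cnorm (1 + z) ^+ 2.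
  have h : 0 <= r * Re zeta by rewrite mulr_ge0//; lra.
  by rewrite zp2; have := sqr_ge0 r; lra.
have zpne : 1 + z != 0.
  by rewrite -cnorm_eq0 -sqrf_eq0 gt_eqF//; lra.
pose a := (1 - z) / (1 + z).
have aE : cayley z * a = 1 by rewrite /cayley /a; field; rewrite zne zpne.
have a2 : cnorm a ^+ 2 <= T ^+ 2 - D0.
  rewrite /a cnormM cnormV expr_div_n zm2 zp2.
  have -> : T ^+ 2 - D0 = (1 - c) / (1 + c) + D0 by rewrite /D0; field; lra.
  apply: (@le_trans _ _ ((1 - c) / (1 + c) + d)); last by rewrite lerD2l.
  rewrite ler_pdivrMr; last by rewrite -zp2; lra.
  rewrite -(@ler_pM2r _ (1 + c)); last by lra.
  have -> : ((1 - c) / (1 + c) + d) * (1 + r ^+ 2 + 2 * r * Re zeta) * (1 + c) =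
     (1 - c + d * (1 + c)) * (1 + r ^+ 2 + 2 * r * Re zeta) by field; lra.
  by apply: disc_ratio_bound => //; [exact: ltW|rewrite /d; ring].
have al0 : 0 <= Re a <= 2 * d.
  have -> : Re a = (1 - r ^+ 2) / cnorm (1 + z) ^+ 2.
    have -> : a = cayley (- z) by rewrite /a /cayley opprK.
    rewrite Re_cayley ?cnormN ?zr ?opprK//.
    by rewrite -subr_eq0 -opprD oppr_eq0 addrC.
  rewrite divr_ge0 ?sqr_ge0//=; last by rewrite subr_ge0 exprn_ile1// ltW.
  rewrite ler_pdivrMr; last by lra.
  have h : 0 <= 2 * d * (cnorm (1 + z) ^+ 2 - 1) by rewrite !mulr_ge0//; lra.
  by move: h; rewrite /d; nra.
move/andP: al0 => [al0 al1].
have sgt := Re_root_fun_gt0 z1.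
have sn0 : 0 < cnorm (s z) by rewrite (lt_le_trans sgt)// Re_le_cnorm.
pose k := (s z)^-1.
have kE : k ^+ 2 * (a ^+ 2 + (T%:C) ^+ 2) = a ^+ 2.
  have : s z ^+ 2 * a ^+ 2 = a ^+ 2 + T%:C ^+ 2.
    have -> : s z ^+ 2 * a ^+ 2 = a ^+ 2 + (T%:C * (cayley z * a)) ^+ 2.
      by rewrite root_fun_sqr; ring.
    by rewrite aE mulr1.
  move=> <-; rewrite mulrA -exprMn mulVf ?expr1n ?mul1r//.
  by rewrite -cnorm_eq0 gt_eqF.
have Pk : Re k = Re (s z) / cnorm (s z) ^+ 2.
  by rewrite /k cnorm_sqr; case: (s z) => p q.
have P2 : Re k ^+ 2 <= d * M.
  by apply: (@Re_root_bound k a) => //; rewrite ?al0 ?ltW//.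
have k0 : 0 <= Re k by rewrite Pk divr_ge0 ?sqr_ge0 ?ltW.
have k4 : 4 * Re k <= 1 - eta.
  have : Re k ^+ 2 <= ((1 - eta) / 4) ^+ 2.
    by rewrite (le_trans P2)// -ler_pdivlMr.
  rewrite ler_pXn2r ?nnegrE ?divr_ge0//; lra.
have w1 := lens_fun_lt1 z1.
have : 1 - cnorm (w z) ^+ 2 <= 4 * Re k.
  rewrite lens_fun_defect Pk -mulrA ler_pM2l// ler_pM2l//.
  rewrite lef_pV2 ?posrE ?exprn_gt0 ?cnorm_gt0 ?root_funD1_neq0//.
    by rewrite !cnorm_sqr cReD cImD /=; nra.
  by rewrite -cnorm_gt0.
by have := cnorm_ge0 (w z); nra.
Qed.

End ArcFunction.

(** * Peak functions of an arc, and the kernel *)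

Section PeakFunction.
Variable R : realType.
Implicit Types (z u v : R[i]).
Local Notation "x %:C" := (real_complex R x) (format "x %:C").

Lemma bernoulli_le (x : R) n : 0 <= x <= 1 -> 1 - n%:R * x <= (1 - x) ^+ n.
Proof.
move=> /andP[x0 x1]; elim: n => [|n IH]; first by rewrite mul0r subr0.
rewrite exprS; have h : 0 <= 1 - x by rewrite subr_ge0.
apply: le_trans (ler_wpM2l h IH); rewrite -natr1.
have : 0 <= n%:R * x * x by rewrite !mulr_ge0.
by lra.
Qed.

(** The first quantity is the Lipschitz constant of [u ^+ n.+1] on [|u| <= q] (see [cdistX]), so a
    single exponent makes both the power and its increments small. *)
Lemma natmul_exp_small (q e : R) : 0 <= q < 1 -> 0 < e ->
  exists n, n.+1%:R * q ^+ n <= e /\ q ^+ n.+1 <= e.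
Proof.
move=> /andP[q0 q1] e0.
have d0 : 0 < 1 - q by rewrite subr_gt0.
have bnd m : m%:R * q ^+ m <= (1 - q)^-1.
  rewrite -(ler_pM2r d0) mulVf ?gt_eqF//.
  have : m%:R * q ^+ m * (1 - q) <= 1 - q ^+ m; last first.
    by move=> h; apply: (le_trans h); rewrite gerBl exprn_ge0.
  elim: m => [|m IH]; first by rewrite !mul0r expr0 subrr.
  rewrite exprS -natr1 mulrDl mul1r mulrDl.
  have h : q * (m%:R * q ^+ m * (1 - q)) <= q * (1 - q ^+ m) by rewrite ler_wpM2l.
  have -> : m%:R * (q * q ^+ m) * (1 - q) = q * (m%:R * q ^+ m * (1 - q)) by ring.
  have h1 : 0 <= (1 - q) * (1 - q * q ^+ m).
    by rewrite mulr_ge0 ?(ltW d0)// subr_ge0 -exprS exprn_ile1// ltW.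
  by lra.
have : q ^+ n @[n --> \oo] --> 0 by apply: cvg_expr; rewrite ger0_norm.
have c0 : 0 < e * (1 - q) / 3 by pos.
move=> /cvgrPdist_le/(_ _ c0)[m _ hm].
have := hm m (leqnn m) => /=; rewrite sub0r normrN ger0_norm ?exprn_ge0// => qm.
have qm1 : q ^+ m <= e.
  apply: (le_trans qm); rewrite ler_pdivrMr//.
  by rewrite ler_pM2l//; lra.
(* [m%:R * q ^+ m] is merely bounded by [bnd]; doubling the exponent supplies a second, small factor
   [q ^+ m]. *)
exists (m + m)%N; split.
  rewrite exprD -natr1 natrD.
  have h1 : m%:R * q ^+ m * q ^+ m <= (1 - q)^-1 * (e * (1 - q) / 3).
    by rewrite ler_pM// ?mulr_ge0 ?exprn_ge0.
  have h2 : (1 - q)^-1 * (e * (1 - q) / 3) = e / 3 by field; rewrite gt_eqF.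
  have h3 : q ^+ m * q ^+ m <= e / 3.
    have h4 : q ^+ m * q ^+ m <= 1 * q ^+ m.
      by rewrite ler_wpM2r ?exprn_ge0// exprn_ile1// ltW.
    apply: (le_trans h4); rewrite mul1r (le_trans qm)//.
    have h5 : 0 <= e * q by rewrite mulr_ge0 ?(ltW e0).
    by lra.
  by move: h1; rewrite h2; lra.
rewrite exprS exprD; have := exprn_ge0 m q0 => h0.
have h1 : q ^+ m <= 1 by rewrite exprn_ile1// ltW.
have h2 : q ^+ m * q ^+ m <= q ^+ m by rewrite ler_piMr.
have h3 : q * (q ^+ m * q ^+ m) <= q ^+ m * q ^+ m.
  by rewrite ler_piMl ?mulr_ge0// ltW.
by rewrite (le_trans h3)// (le_trans h2).
Qed.

Lemma cdistX (q : R) n u v : cnorm u <= q -> cnorm v <= q ->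
  cnorm (u ^+ n.+1 - v ^+ n.+1) <= n.+1%:R * q ^+ n * cnorm (u - v).
Proof.
move=> uq vq; have q0 : 0 <= q by exact: le_trans (cnorm_ge0 u) uq.
elim: n => [|n IH]; first by rewrite !expr1 expr0 !mul1r.
have -> : u ^+ n.+2 - v ^+ n.+2 = u * (u ^+ n.+1 - v ^+ n.+1) + (u - v) * v ^+ n.+1.
  by rewrite ![_ ^+ n.+2]exprS; ring.
rewrite (le_trans (cnormD _ _))// !cnormM cnormX.
have -> : n.+2%:R * q ^+ n.+1 * cnorm (u - v) =
    q * (n.+1%:R * q ^+ n * cnorm (u - v)) + cnorm (u - v) * q ^+ n.+1.
  by rewrite -natr1 [q ^+ n.+1]exprS; ring.
apply: lerD; first by rewrite ler_pM ?cnorm_ge0.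
by rewrite ler_wpM2l ?cnorm_ge0// lerXn2r ?nnegrE ?cnorm_ge0.
Qed.

(** [W] is a power of [lens_fun T] at [rho * z]. The order of choices matters: [T] and [q] first,
    then the exponent that makes [q ^+ n.+1] small, and [rho] last, so close to 1 that the power
    does not spoil the lower bound on the arc. *)
Lemma peak_fun (c c' A r0 e eta : R) : 0 <= c -> c < c' -> c' < 1 -> 0 < A ->
  0 <= r0 < 1 -> 0 < e -> 0 <= eta < 1 ->
  exists W : R[i] -> R[i],
  [/\ forall z, cnorm z <= 1 -> hol W z /\ cnorm (W z) < 1,
      forall zeta z, cnorm zeta = 1 -> Re zeta <= c -> cnorm z <= 1 ->
        cnorm (z - zeta) <= A * (1 - cnorm z ^+ 2) -> cnorm (W z) <= e,
      forall z, cnorm z <= r0 -> cnorm (W z) <= e,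
      forall z u, cnorm z <= r0 -> cnorm u <= r0 ->
        cnorm (W z - W u) <= e * cnorm (z - u) &
      forall zeta, cnorm zeta = 1 -> c' <= Re zeta -> eta <= cnorm (W zeta)].
Proof.
move=> c0 cc' c1 A0 /andP[r00 r01] e0 /andP[eta0 eta1].
pose m := (c + c') / 2.
have m0 : c < m by rewrite /m; lra.
have m1 : m < c' by rewrite /m; lra.
(* With this [T], [lens_fun] is unimodular exactly on the arc [m < Re zeta], and [m] lies strictly
   between the two thresholds. *)
pose T := Num.sqrt ((1 - m) / (1 + m)).
have T2 : T ^+ 2 = (1 - m) / (1 + m) by rewrite sqr_sqrtr// divr_ge0//; lra.
have T0 : 0 < T by rewrite sqrtr_gt0 divr_gt0//; lra.
have Tc : T ^+ 2 * (1 + c) < 1 - c.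
  by rewrite T2 mulrAC ltr_pdivrMr//; [nra|lra].
have Tc' : 1 - c' < T ^+ 2 * (1 + c').
  by rewrite T2 mulrAC ltr_pdivlMr//; [nra|lra].
have r02 : 0 < 1 - r0 ^+ 2 by rewrite subr_gt0 expr_lt1.
(* The 1 pays for moving [z] to [rho * z]. The last term puts the disc of radius [r0] into the Stolz
   domain of the vertex -1, so smallness on that disc is a case of the nontangential bound. *)
pose A1 := A + 1 + 2 / (1 - r0 ^+ 2).
have A2 : 0 < 2 / (1 - r0 ^+ 2) by pos.
have A10 : 0 < A1 by rewrite /A1; lra.
have c1' : c < 1 by lra.
have [q /andP[q0 q1] hq] := @lens_fun_nontangential R T T0 c A1 c1' A10 Tc.
have r0r : 0 <= r0 < 1 by rewrite r00.
have [L L0 hL] := @lens_fun_lipschitz R T T0 r0 r0r.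
have e'0 : 0 < e / (L + 1) by rewrite divr_gt0//; lra.
have q01 : 0 <= q < 1 by rewrite q0.
have me0 : 0 < Num.min e (e / (L + 1)) by rewrite lt_min e0.
have [n [hn1 hn2]] := natmul_exp_small q01 me0.
move: hn1 hn2; rewrite !le_min => /andP[_ hn1] /andP[hn2 _].
(* By Bernoulli, modulus at least [1 - x] before the power leaves at least [eta] after it. *)
pose x := (1 - eta) / n.+2%:R.
have x0 : 0 < x by rewrite divr_gt0// subr_gt0.
have xn : n.+1%:R * x <= 1 - eta.
  by rewrite /x mulrCA ler_piMr ?subr_ge0 ?(ltW eta1)// ler_pdivrMr// mul1r ler_nat.
have x1 : x <= 1.
  rewrite /x ler_pdivrMr// mul1r; have : 1 <= n.+2%:R :> R by rewrite ler1n.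
  by lra.
have c'r : 0 <= c' < 1 by apply/andP; split; lra.
have x1' : 1 - x < 1 by rewrite gtrBl.
have [r1 /andP[r10 r11] hr] := @lens_fun_arc R T T0 c' (1 - x) c'r Tc' x1'.
pose rho := (1 + r1) / 2.
have rho1 : rho < 1 by rewrite /rho; lra.
have rho0 : 0 < rho by rewrite /rho; lra.
have rhor : r1 <= rho by rewrite /rho; lra.
have nrho z : cnorm (rho%:C * z) = rho * cnorm z.
  by rewrite cnormM cnorm_real gtr0_norm.
have lt1 z : cnorm z <= 1 -> cnorm (rho%:C * z) < 1.
  by move=> z1; rewrite nrho (le_lt_trans _ rho1)// ler_piMr// ltW.
have small z : cnorm (lens_fun T z) <= q -> cnorm (lens_fun T z ^+ n.+1) <= e.
  move=> h; rewrite cnormX (le_trans _ hn2)// lerXn2r// nnegrE cnorm_ge0//.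
have nontan zeta z : cnorm zeta = 1 -> Re zeta <= c -> cnorm z <= 1 ->
    cnorm (z - zeta) <= (A + 2 / (1 - r0 ^+ 2)) * (1 - cnorm z ^+ 2) ->
    cnorm (lens_fun T (rho%:C * z)) <= q.
  move=> zeta1 hz z1 hz2; apply: (hq zeta) => //; first exact: lt1.
  rewrite (le_trans (cdist_triangle z _ _))//.
  have z0 := cnorm_ge0 z.
  have -> : rho%:C * z - z = - ((1 - rho)%:C * z) by rewrite rmorphB rmorph1 /=; ring.
  rewrite cnormN cnormM cnorm_real gtr0_norm ?subr_gt0// nrho exprMn.
  have h1 : (1 - rho) * cnorm z <= 1 - rho by rewrite ler_piMr// subr_ge0 ltW.
  have z2 : cnorm z ^+ 2 <= 1 by rewrite exprn_ile1.
  have rr : rho ^+ 2 <= rho by rewrite expr2 ler_piMr// ltW.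
  have z20 := sqr_ge0 (cnorm z).
  have h2 : rho ^+ 2 * cnorm z ^+ 2 <= rho * 1.
    by rewrite ler_pM ?sqr_ge0.
  have h3 : rho ^+ 2 * cnorm z ^+ 2 <= cnorm z ^+ 2.
    by rewrite ler_piMl// exprn_ile1// ltW.
  have h4 : (A + 2 / (1 - r0 ^+ 2)) * (1 - cnorm z ^+ 2) <=
      (A + 2 / (1 - r0 ^+ 2)) * (1 - rho ^+ 2 * cnorm z ^+ 2).
    by rewrite ler_pM2l ?lerD2l ?lerN2//; lra.
  have -> : A1 = A + 2 / (1 - r0 ^+ 2) + 1 by rewrite /A1; ring.
  by rewrite mulrDl mul1r; lra.
have in_disc z : cnorm z <= r0 -> cnorm (lens_fun T (rho%:C * z)) <= q.
  move=> zr; have z1 : cnorm z <= 1 by rewrite (le_trans zr)// ltW.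
  have n1 : cnorm (-1 : R[i]) = 1 by rewrite cnormN cnorm1.
  apply: (nontan (-1)) => //; first by rewrite cReN /=; lra.
  rewrite (le_trans (cnormB _ _))// n1.
  have h1 : cnorm z ^+ 2 <= r0 ^+ 2 by rewrite lerXn2r// nnegrE ?cnorm_ge0.
  have h2 : 2 / (1 - r0 ^+ 2) * (1 - r0 ^+ 2) = 2 by rewrite divfK// gt_eqF.
  have h3 : 2 / (1 - r0 ^+ 2) * (1 - r0 ^+ 2) <= 2 / (1 - r0 ^+ 2) * (1 - cnorm z ^+ 2).
    by rewrite ler_pM2l// lerD2l lerN2.
  have h4 : 0 <= A * (1 - cnorm z ^+ 2) by rewrite mulr_ge0//; lra.
  by rewrite mulrDl; lra.
exists (fun z => lens_fun T (rho%:C * z) ^+ n.+1); split.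
- move=> z z1; split; last first.
    rewrite cnormX exprn_ilt1 ?cnorm_ge0 ?lens_fun_lt1//; exact: lt1.
  apply: holX; apply: (@hol_comp _ (fun z => rho%:C * z) (lens_fun T)).
    by apply: holM; [exact: hol_cst|exact: hol_id].
  by apply: hol_lens_fun => //; exact: lt1.
- move=> zeta z zeta1 hz z1 hz2; apply: small; apply: (nontan zeta) => //.
  rewrite (le_trans hz2)// mulrDl lerDl mulr_ge0 ?(ltW A2)//.
  by rewrite subr_ge0 exprn_ile1 ?cnorm_ge0.
- by move=> z zr; apply: small; exact: in_disc.
- move=> z u zr ur.
  have scale v : cnorm v <= r0 -> cnorm (rho%:C * v) <= r0.
    by move=> vr; rewrite nrho (le_trans _ vr)// ler_piMl ?cnorm_ge0// ltW.
  rewrite (le_trans (cdistX _ (in_disc z zr) (in_disc u ur)))//.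
  have h := hL _ _ (scale z zr) (scale u ur).
  have h2 : cnorm (rho%:C * z - rho%:C * u) <= cnorm (z - u).
    by rewrite -mulrBr nrho ler_piMl ?cnorm_ge0// ltW.
  have h3 : cnorm (lens_fun T (rho%:C * z) - lens_fun T (rho%:C * u)) <=
      (L + 1) * cnorm (z - u).
    rewrite (le_trans h)// ler_pM ?cnorm_ge0//; lra.
  apply: (@le_trans _ _ (e / (L + 1) * ((L + 1) * cnorm (z - u)))).
    by rewrite ler_pM ?mulr_ge0 ?exprn_ge0 ?cnorm_ge0.
  by rewrite mulrA divfK// gt_eqF//; lra.
- move=> zeta zeta1 hz; rewrite cnormX.
  have h := hr rho zeta; rewrite rhor rho1 in h.
  have := h isT zeta1 hz => h1.
  apply: (@le_trans _ _ ((1 - x) ^+ n.+1)).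
    by apply: le_trans (bernoulli_le _ _); [lra|rewrite ltW].
  by rewrite lerXn2r// nnegrE ?cnorm_ge0// subr_ge0.
Qed.

Definition kern u := 1 - cayley u.

Lemma kernE u : u != 1 -> kern u = - (2%:R%:C * u) / (1 - u).
Proof.
rewrite eq_sym -subr_eq0 => u1.
by rewrite /kern /cayley rmorph_nat; field.
Qed.

Lemma Re_kern u : u != 1 -> Re (kern u) = 1 - (1 - cnorm u ^+ 2) / cnorm (1 - u) ^+ 2.
Proof. by move=> u1; rewrite /kern cReB Re_cayley. Qed.

Lemma cdist1_ge u : 1 - cnorm u <= cnorm (1 - u).
Proof. by rewrite (le_trans _ (cdistB _ _))// cnorm1. Qed.

Lemma cnorm_kern (r : R) u : cnorm u <= r -> r < 1 -> cnorm (kern u) <= 2 * r / (1 - r).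
Proof.
move=> ur r1; have u1 : cnorm u < 1 by exact: le_lt_trans r1.
have h : 0 < 1 - r by rewrite subr_gt0.
have h2 : 1 - r <= cnorm (1 - u) by rewrite (le_trans _ (cdist1_ge u))// lerD2l lerN2.
rewrite kernE ?ltn1_neq1// cnormM cnormN cnormM cnorm_real ger0_norm// cnormV.
rewrite ler_pM ?mulr_ge0 ?invr_ge0 ?cnorm_ge0// ?ler_wpM2l//.
by rewrite lef_pV2 ?posrE// (lt_le_trans h).
Qed.

Lemma kern_lipschitz u v : cnorm u <= 1 / 2 -> cnorm v <= 1 / 2 ->
  cnorm (kern u - kern v) <= 8 * cnorm (u - v).
Proof.
move=> hu hv; have u1 : cnorm u < 1 by lra.
have v1 : cnorm v < 1 by lra.
have -> : kern u - kern v = - (cayley u - cayley v) by rewrite /kern; ring.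
rewrite cnormN cdist_cayley ?ltn1_neq1// mulrAC ler_wpM2r ?cnorm_ge0//.
have h1 : 1 / 2 <= cnorm (1 - u) by rewrite (le_trans _ (cdist1_ge u))//; lra.
have h2 : 1 / 2 <= cnorm (1 - v) by rewrite (le_trans _ (cdist1_ge v))//; lra.
have h3 : (1 / 2) * (1 / 2) <= cnorm (1 - u) * cnorm (1 - v).
  by rewrite ler_pM//; lra.
by rewrite ler_pdivrMr; lra.
Qed.

Lemma hol_kern u : cnorm u < 1 -> hol kern u.
Proof.
move=> u1; apply: holB; first exact: hol_cst.
apply: holM; first by apply: holD; [exact: hol_cst|exact: hol_id].
apply: holV; last by apply: holB; [exact: hol_cst|exact: hol_id].
by rewrite subr_eq0 eq_sym ltn1_neq1.
Qed.

End PeakFunction.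

(** * Separated phases, arcs and pigeonhole *)

Section StageTools.
Variable R : realType.
Implicit Types (z u v : R[i]) (x t : R).
Local Notation "x %:C" := (real_complex R x) (format "x %:C").
Local Notation mu := (@lebesgue_measure R).

(** The phases are the Cayley images of the points [i k / n] of the imaginary axis: [cdist_cayley]
    makes their distances explicit, and [|1 - a k|^2 <= 2] gives the separation. *)
Lemma separated_unimodular n : exists p : nat -> R[i],
  (forall k, cnorm (p k) = 1) /\
  forall k l, (k < n)%N -> (l < n)%N -> k != l -> n%:R^-1 <= cnorm (p k - p l).
Proof.
pose a k : R[i] := Complex 0 (k%:R / n%:R).
have na1 k : cnorm (1 - a k) ^+ 2 = 1 + (k%:R / n%:R) ^+ 2.
  by rewrite cnorm_sqr cReB cImB /=; ring.
have na2 k : cnorm (1 + a k) ^+ 2 = 1 + (k%:R / n%:R) ^+ 2.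
  by rewrite cnorm_sqr cReD cImD /=; ring.
have a1 k : a k != 1.
  by apply/eqP => /(congr1 (@complex.Re R))/= /eqP; rewrite eq_sym oner_eq0.
have gt0 k : 0 < cnorm (1 - a k) by rewrite cnorm_gt0 subr_eq0 eq_sym.
exists (fun k => cayley (a k)); split.
  move=> k; rewrite /cayley cnormM cnormV.
  have -> : cnorm (1 + a k) = cnorm (1 - a k); last by rewrite divff// gt_eqF.
  by apply/eqP; rewrite -(@eqrXn2 _ 2) ?cnorm_ge0// na1 na2.
move=> k l kn ln kl.
have n0 : 0 < n%:R :> R by rewrite ltr0n (leq_trans _ kn).
have le2 m : (m < n)%N -> cnorm (1 - a m) ^+ 2 <= 2.
  move=> mn; rewrite na1 -[2]/(1 + 1) lerD2l exprn_ile1 ?divr_ge0//.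
  by rewrite ler_pdivrMr// mul1r ler_nat ltnW.
rewrite cdist_cayley//.
have -> : cnorm (a k - a l) = `|k%:R - l%:R| / n%:R.
  have -> : a k - a l = Complex 0 ((k%:R - l%:R) / n%:R).
    by apply: complex_eqP; rewrite ?cReB ?cImB /= ?subrr// mulrBl.
  by rewrite /= expr0n add0r sqrtr_sqr normrM [`|n%:R^-1|]gtr0_norm ?invr_gt0.
have kl1 : 1 <= `|k%:R - l%:R| :> R.
  wlog lk : k l kn ln kl / (l < k)%N.
    move=> H; case: (ltngtP l k) => [|h|h]; first exact: H.
      by rewrite distrC; apply: H => //; rewrite eq_sym.
    by rewrite h eqxx in kl.
  by rewrite -natrB ?(ltnW lk)// normr_nat ler1n subn_gt0.
have h : cnorm (1 - a k) * cnorm (1 - a l) <= 2.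
  have := le2 k kn; have := le2 l ln.
  by have := sqr_ge0 (cnorm (1 - a k) - cnorm (1 - a l)); lra.
rewrite ler_pdivlMr ?mulr_gt0// [leRHS]mulrA [leLHS]mulrC ler_pM2r ?invr_gt0//; lra.
Qed.

Lemma cos_le_outside (h x : R) : 0 <= h <= pi -> h <= x <= pi *+ 2 - h -> cos x <= cos h.
Proof.
have mono (a b : R) : 0 <= a -> a <= b -> b <= pi -> cos b <= cos a.
  move=> a0 ab bpi; have ha : a \in `[0, pi] by rewrite in_itv/= a0 (le_trans ab).
  have hb : b \in `[0, pi] by rewrite in_itv/= bpi (le_trans a0).
  by rewrite leNgt ltr_cos// -leNgt.
move=> /andP[h0 hpi] /andP[hx xh]; have [xpi|xpi] := leP x pi; first exact: mono.
rewrite -(cosN x) -cosD2pi addrC; apply: mono => //; first by lra.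
by move: xpi; rewrite mulr2n; lra.
Qed.

Lemma Re_conj_expi_mul s t : Re (conjc (expi s) * expi t) = cos (t - s).
Proof. by rewrite cosB /=; ring. Qed.

Lemma arc_index (n : nat) t : (0 < n)%N -> 0 <= t < pi *+ 2 ->
  exists i : 'I_n, `|t - (i%:R *+ 2 + 1) * (pi / n%:R)| <= pi / n%:R.
Proof.
move=> n0 /andP[t0 t2].
have nR : 0 < n%:R :> R by rewrite ltr0n.
have pi0 := pi_gt0 R.
pose h : R := pi / n%:R; have h0 : 0 < h by rewrite divr_gt0.
have nh : n%:R * (h *+ 2) = pi *+ 2 by rewrite mulrnAr mulrC divfK ?gt_eqF.
have ex : exists k, t < k%:R * (h *+ 2) by exists n; rewrite nh.
(* The first right endpoint beyond [t]; the arc containing [t] therefore has index [k.-1]. *)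
have [k kt kmin] := ex_minnP ex.
have k0 : (0 < k)%N by case: k kt {kmin}; rewrite ?mul0r// ltNge t0.
have kn : (k.-1 < n)%N.
  by rewrite prednK//; apply: kmin; rewrite nh.
exists (Ordinal kn) => /=; rewrite -/h.
have lb : k.-1%:R * (h *+ 2) <= t.
  by rewrite leNgt; apply/negP => /kmin; rewrite leqNgt prednK// leqnn.
have E : k%:R = k.-1%:R + 1 :> R by rewrite natr1 prednK.
rewrite E in kt; move: kt lb; rewrite !mulr2n => kt lb.
by rewrite ler_norml; apply/andP; split; lra.
Qed.

Lemma pigeonhole_measure (B : nat -> set R) (D : set R) n (l b : R) :
  measurable D -> (mu D <= l%:E)%E -> (forall k, measurable (B k)) ->
  (forall k, (k < n)%N -> B k `<=` D) ->
  (forall k m t, (k < n)%N -> (m < n)%N -> B k t -> B m t -> k = m) ->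
  l < n%:R * b -> exists2 k, (k < n)%N & (mu (B k) <= b%:E)%E.
Proof.
move=> mD Dl mB BD tB lb; apply/not_exists2P => H.
pose B' k := if (k < n)%N then B k else set0.
have mB' k : measurable (B' k) by rewrite /B'; case: ifP.
have tB' : trivIset [set: nat] B'.
  apply/trivIsetP => i j _ _ ij; apply/seteqP; split => // t [].
  rewrite /B'; case: ifP => // hi Bi; case: ifP => // hj Bj.
  by move/eqP: ij; apply; exact: (tB i j t).
have := measure_bigsetU mu mB' tB' n => E.
have U : (mu (\big[setU/set0]_(i < n) B' i) <= mu D)%E.
  apply: le_measure; [by rewrite inE; apply: bigsetU_measurable => i _; exact: mB'|by rewrite inE|].
  by rewrite -bigcup_mkord => t [i /= hi]; rewrite /B' hi; exact: BD.
have : ((n%:R * b)%:E <= l%:E)%E; last by rewrite lee_fin leNgt lb.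
apply: le_trans (le_trans U Dl); rewrite E.
have -> : (n%:R * b)%:E = (\sum_(i < n) b%:E)%E.
  by rewrite sumEFin sumr_const card_ord mulr_natl.
apply: lee_sum => i _; rewrite /B' ltn_ord leNgt; apply/negP => h.
by case: (H i) => //; apply; exact: ltW.
Qed.

Lemma sum_offdiag n (F : 'I_n -> R[i]) i (B : R) : 0 <= B ->
  (forall j, j != i -> cnorm (F j) <= B) ->
  cnorm (\sum_j F j - F i) <= n%:R * B.
Proof.
move=> B0 hF; rewrite (bigD1 i)//= addrAC subrr add0r.
rewrite (le_trans (cnorm_sum _ _ _))//.
apply: (@le_trans _ _ (\sum_(j < n) B)).
  by rewrite [leRHS](bigD1 i)//= (le_trans (ler_sum _ hF))// lerDr.
by rewrite sumr_const card_ord mulr_natl.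
Qed.

Lemma sum_le_card n (F : 'I_n -> R[i]) (B : R) :
  (forall j, cnorm (F j) <= B) -> cnorm (\sum_j F j) <= n%:R * B.
Proof.
move=> hF; rewrite (le_trans (cnorm_sum _ _ _))//.
apply: (le_trans (ler_sum _ (fun j _ => hF j))).
by rewrite sumr_const card_ord mulr_natl.
Qed.

(** The quantity is the Poisson kernel of [v], with numerator at most [4 * x] and denominator at
    least [(s / 2) ^+ 2]. The hypothesis has [2 * x] because [v] loses modulus twice: through the
    damping factor and through [W]. *)
Lemma kern_near_circle (x s : R) v : 0 < s -> 0 <= x -> cnorm v < 1 ->
  1 - 2 * x <= cnorm v -> s / 2 <= cnorm (1 - v) ->
  `|1 - Re (kern v)| <= 16 * x / s ^+ 2.
Proof.
move=> s0 x0 v1 vx vs; rewrite Re_kern ?ltn1_neq1//.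
have v0 := cnorm_ge0 v.
have h1 : 0 <= 1 - cnorm v ^+ 2 by rewrite subr_ge0 exprn_ile1// ltW.
have -> : 1 - (1 - (1 - cnorm v ^+ 2) / cnorm (1 - v) ^+ 2) =
  (1 - cnorm v ^+ 2) / cnorm (1 - v) ^+ 2 by ring.
have g0 : 0 < cnorm (1 - v) by rewrite (lt_le_trans _ vs)// divr_gt0.
rewrite ger0_norm ?divr_ge0 ?sqr_ge0//.
have -> : 16 * x / s ^+ 2 = 4 * x / (s / 2) ^+ 2 by field; rewrite gt_eqF.
apply: ler_pM => //; first by rewrite invr_ge0 sqr_ge0.
  have := sqr_ge0 (1 - cnorm v); lra.
by rewrite lef_pV2 ?posrE ?exprn_gt0 ?divr_gt0// lerXn2r// nnegrE ltW// divr_gt0.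
Qed.

Lemma expi_dist (t u : R) : cnorm (expi t - expi u) <= `|cos t - cos u| + `|sin t - sin u|.
Proof. by rewrite (le_trans (cnorm_le_ReIm _))// cReB cImB. Qed.

Lemma open_hol_expi (W : R[i] -> R[i]) (a p : R[i]) (s : R) : cnorm a = 1 ->
  (forall z, cnorm z <= 1 -> hol W z) ->
  open [set t : R | cnorm (p - W (a * expi t)) < s].
Proof.
move=> a1 hW; rewrite openE => t /= ht; rewrite /interior.
have at1 : cnorm (a * expi t) <= 1 by rewrite cnormM a1 cnorm_expi mulr1.
have e0 : 0 < s - cnorm (p - W (a * expi t)) by rewrite subr_gt0.
have [d d0 hd] := hol_cont (hW _ at1) e0.
have d2 : 0 < d / 2 by rewrite divr_gt0.
have hc : \forall u \near t, `|cos t - cos u| < d / 2.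
  by have /cvgrPdist_lt := @continuous_cos R t; exact.
have hs : \forall u \near t, `|sin t - sin u| < d / 2.
  by have /cvgrPdist_lt := @continuous_sin R t; exact.
near=> u => /=.
have hu : cnorm (a * expi u - a * expi t) < d.
  rewrite -mulrBr cnormM a1 mul1r cdistC (le_lt_trans (expi_dist _ _))//.
  by rewrite [ltRHS]splitr ltrD//; near: u.
have := hd _ hu; rewrite cdistC => h.
rewrite (le_lt_trans (cdist_triangle (W (a * expi t)) _ _))//.
by rewrite -ltrBrDl.
Unshelve. all: by end_near.
Qed.

End StageTools.

(** * One correction of the boundary residual *)

Section Stage.
Variable R : realType.
Implicit Types (z u v : R[i]) (x t : R).
Local Notation "x %:C" := (real_complex R x) (format "x %:C").
Local Notation mu := (@lebesgue_measure R).

Lemma le_unit_sub_sqr z : cnorm z <= 1 -> 0 <= 1 - cnorm z ^+ 2.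
Proof. by move=> z1; rewrite subr_ge0 exprn_ile1 ?cnorm_ge0. Qed.

Lemma cnorm_kern_small (e : R) v : e <= 1 / 2 -> cnorm v <= e -> cnorm (kern v) <= 4 * e.
Proof.
move=> e2 ve; have e0 := le_trans (cnorm_ge0 v) ve.
rewrite (le_trans (cnorm_kern ve _))//; first by lra.
rewrite ler_pdivrMr; last by lra.
have : 0 <= e * (1 - 2 * e) by rewrite mulr_ge0//; lra.
by lra.
Qed.

Lemma measurable_tooth (W : R[i] -> R[i]) (a p : R[i]) (s x y : R) : cnorm a = 1 ->
  (forall z, cnorm z <= 1 -> hol W z) ->
  measurable ([set t : R | `|t - x| <= y] `&` [set t : R | cnorm (p - W (a * expi t)) < s]).
Proof.
move=> a1 hW; apply: measurableI; last by apply: open_measurable; exact: open_hol_expi.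
have -> : [set t : R | `|t - x| <= y] = `[x - y, x + y]%classic.
  by apply/seteqP; split => t; rewrite /= in_itv/= ler_distl.
exact: measurable_itv.
Qed.

(** Near the ends of its own arc a peak function satisfies neither its upper nor its lower bound;
    these edges are put into the exceptional set. *)
Lemma measure_edges n (s : nat -> R) (h d : R) : 0 < d ->
  let E := \big[setU/set0]_(j < n)
    (`[s j - h, s j - h + d]%classic `|` `[s j + h - d, s j + h]%classic) in
  measurable E /\ (mu E <= (n%:R * (2 * d))%:E)%E.
Proof.
move=> d0; pose Ej j := `[s j - h, s j - h + d]%classic `|` `[s j + h - d, s j + h]%classic.
have m j : measurable (Ej j) by apply: measurableU; exact: measurable_itv.
split; first by apply: bigsetU_measurable => i _; exact: m.
apply: le_trans (Boole_inequality mu (n := n) (A := Ej) (fun j _ => m j)) _.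
have -> : (n%:R * (2 * d))%:E = (\sum_(i < n) (2 * d)%:E)%E.
  by rewrite sumEFin sumr_const card_ord mulr_natl.
apply: lee_sum => i _; apply: (le_trans (measureU2 _ _ _)); [exact: measurable_itv..|].
have l1 (a : R) : (mu `[a, (a + d)%R]%classic <= d%:E)%E.
  by rewrite lebesgue_measure_itv /= lte_fin ltrDl d0 -EFinB addrAC subrr add0r lexx.
have -> : `[s i + h - d, s i + h] = `[s i + h - d, (s i + h - d) + d] by rewrite subrK.
apply: le_trans (leeD (l1 _) (l1 _)) _.
by rewrite -EFinD lee_fin; lra.
Qed.

Lemma mem_bigsetU n (F : nat -> set R) t :
  (\big[setU/set0]_(j < n) F j) t <-> exists2 j, (j < n)%N & F j t.
Proof. by rewrite -bigcup_mkord; split=> -[j /= jn hj]; exists j. Qed.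

Definition arc_mid (n j : nat) : R := (j%:R *+ 2 + 1) * (pi / n%:R).

Lemma arc_midD n j i : (j < i)%N -> arc_mid n j + 2 * (pi / n%:R) <= arc_mid n i.
Proof.
move=> ji; have h0 : 0 <= pi / n%:R :> R by rewrite divr_ge0// pi_ge0.
have ji1 : j%:R + 1 <= i%:R :> R by rewrite natr1 ler_nat.
have := ler_wpM2r h0 ji1; rewrite /arc_mid !mulr2n; lra.
Qed.

Lemma arc_mid_ge n j : pi / n%:R <= arc_mid n j.
Proof.
have h0 : 0 <= pi / n%:R :> R by rewrite divr_ge0// pi_ge0.
have -> : arc_mid n j = j%:R *+ 2 * (pi / n%:R) + pi / n%:R by rewrite /arc_mid; ring.
by rewrite lerDr mulr_ge0// mulrn_wge0.
Qed.

Lemma arc_mid_le n j : (j < n)%N -> arc_mid n j + pi / n%:R <= pi *+ 2.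
Proof.
move=> jn; have h0 : 0 <= pi / n%:R :> R by rewrite divr_ge0// pi_ge0.
have nh : n%:R * (pi / n%:R) = pi :> R.
  by rewrite mulrC divfK// pnatr_eq0 -lt0n (leq_trans _ jn).
have jn1 : j%:R + 1 <= n%:R :> R by rewrite natr1 ler_nat.
have := ler_wpM2r h0 jn1; rewrite nh /arc_mid !mulr2n; lra.
Qed.

Lemma cos_other_arc n (i j : 'I_n) t : j != i ->
  `|t - arc_mid n i| <= pi / n%:R -> cos (t - arc_mid n j) <= cos (pi / n%:R).
Proof.
move=> ji; have n1 : 1 <= n%:R :> R by rewrite ler1n (leq_trans _ (ltn_ord i)).
have h0pi : 0 <= (pi : R) / n%:R <= pi.
  rewrite divr_ge0 ?pi_ge0//= ler_pdivrMr; last by lra.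
  by rewrite ler_peMr// pi_ge0.
rewrite ler_norml => /andP[t1 t2].
have := arc_mid_ge n i; have := arc_mid_ge n j.
have := arc_mid_le (ltn_ord i); have := arc_mid_le (ltn_ord j).
case: (ltngtP j i) ji => [lt _|lt _|/val_inj -> /eqP//]; have := arc_midD n lt => *.
  by apply: cos_le_outside => //; apply/andP; split; lra.
by rewrite -cosN opprB; apply: cos_le_outside => //; apply/andP; split; lra.
Qed.

Lemma cos_same_arc (t h : R) : 0 <= h <= pi -> `|t| <= h -> cos h <= cos t.
Proof.
move=> /andP[h0 hpi] th; rewrite -[cos t]cos_norm leNgt ltr_cos ?in_itv/= ?h0 ?hpi//.
  by rewrite -leNgt.
by rewrite normr_ge0 (le_trans th).
Qed.

(* The sets where [W] is within half the separation of one of [n0] unimodular phases are disjoint, so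
   one of the phases is approached only on a set of small measure. *)
Lemma phase_select (N n0 : nat) (del b : R) (W : R[i] -> R[i]) : 0 < del ->
  (forall z, cnorm z <= 1 -> hol W z) -> pi *+ 2 < n0%:R * b ->
  exists (p : R[i]) (B : set R), [/\ cnorm p = 1, measurable B, (mu B <= b%:E)%E &
    forall j t, (j < N)%N -> `|t - arc_mid N j| <= pi / N%:R - del -> ~ B t ->
      (2 * n0%:R)^-1 <= cnorm (p - W (conjc (expi (arc_mid N j)) * expi t))].
Proof.
move=> del0 hW npi.
have [p [p1 psep]] := separated_unimodular R n0.
pose a j : R[i] := conjc (expi (arc_mid N j)).
have a1 j : cnorm (a j) = 1 by rewrite cnorm_conj cnorm_expi.
pose T k j := [set t : R | `|t - arc_mid N j| <= pi / N%:R - del] `&`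
  [set t : R | cnorm (p k - W (a j * expi t)) < (2 * n0%:R)^-1].
pose B k := \big[setU/set0]_(j < N) T k j.
have mB k : measurable (B k).
  by apply: bigsetU_measurable => j _; exact: measurable_tooth.
have [k kn0 muB] : exists2 k, (k < n0)%N & (mu (B k) <= b%:E)%E.
  apply: (@pigeonhole_measure R B `[0, pi *+ 2]%classic n0 (pi *+ 2) b) => //.
  - by rewrite lebesgue_measure_itv /= lte_fin mulrn_wgt0 ?pi_gt0// -EFinB subr0.
  - move=> k _ t /mem_bigsetU[j jN [/= tj _]]; rewrite in_itv/=.
    move: tj; rewrite ler_norml => /andP[t1 t2].
    by have := arc_mid_ge N j; have := arc_mid_le jN => *; apply/andP; split; lra.
  - move=> k m t kn0 mn0 /mem_bigsetU[j jN [/= tj hk]] /mem_bigsetU[i iN [/= ti hm]].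
    move: tj ti; rewrite !ler_norml => /andP[tj1 tj2] /andP[ti1 ti2].
    have ij : i = j.
      by case: (ltngtP i j) => // lt; have h := arc_midD N lt; exfalso; lra.
    rewrite ij in hm; apply/eqP/negPn/negP => km.
    have := psep _ _ kn0 mn0 km; apply/negP; rewrite -ltNge.
    rewrite (le_lt_trans (cdist_triangle (W (a j * expi t)) _ _))//.
    rewrite [X in _ + X]cdistC (lt_le_trans (ltrD hk hm))//.
    by rewrite invfM -mulrDl (_ : 2^-1 + 2^-1 = 1) ?mul1r//; field.
exists (p k), (B k); split => // j t jN tj nB.
by rewrite leNgt; apply/negP => hW2; apply: nB; apply/mem_bigsetU; exists j.
Qed.

(** The conditions under which [peak_fun] applies with thresholds at the end of an arc and at the
    inner end of its edge; [4 <= N] gives the first. *)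
Lemma peak_exponents (N : nat) (del : R) : (4 <= N)%N -> 0 < del ->
  del <= pi / N%:R / 2 ->
  [/\ 0 <= cos (pi / N%:R : R), cos (pi / N%:R) < cos (pi / N%:R - del) &
      cos (pi / N%:R - del) < 1].
Proof.
move=> N4 del0 delh; set h := pi / N%:R in delh *.
have pi0 := pi_gt0 R.
have N0 : 0 < N%:R :> R by rewrite ltr0n (leq_trans _ N4).
have h2 : h <= pi / 2.
  by rewrite /h ler_pM2l// lef_pV2 ?posrE// ler_nat (leq_trans _ N4).
have h0 : 0 < h by rewrite divr_gt0.
clearbody h.
have in_pi (x : R) : 0 <= x -> x <= pi -> x \in `[0, pi] by move=> *; rewrite in_itv/=; apply/andP.
split.
- by rewrite -cos_pihalf leNgt ltr_cos ?in_pi -?leNgt//; lra.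
- by rewrite ltr_cos ?in_pi//; lra.
- by rewrite -[ltRHS]cos0 ltr_cos ?in_pi//; lra.
Qed.

Lemma in_edge (t s h d : R) : `|t - s| <= h -> h - d < `|t - s| ->
  (`[s - h, s - h + d]%classic `|` `[s + h - d, s + h]%classic) t.
Proof.
rewrite ler_norml => /andP[t1 t2].
rewrite ltr_normr => /orP[ti2|ti2]; [right|left];
  by rewrite /= in_itv/=; apply/andP; split; lra.
Qed.

(* [X c] serves as [1 - r]: the error [|c| * X c] has to be small for all [c], while the bound
   [2 * |c| / X c] of the block has to be small when [|c| <= 2 * tau]. *)
Lemma damping (C tau k : R) : 0 < C -> 0 < tau -> 0 < k -> exists X : R -> R,
  [/\ forall c, 0 < X c, forall c, X c <= k, forall c, `|c| * X c <= k * tau,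
      exists2 x, 0 < x & forall c, `|c| <= C -> x <= X c &
      forall c, `|c| <= 2 * tau -> `|c| * (2 / X c) <= 8 * tau / k].
Proof.
move=> C0 tau0 k0; pose X (c : R) := k * tau / Num.max `|c| tau.
have mx0 (c : R) : 0 < Num.max `|c| tau by rewrite lt_max tau0 orbT.
exists X; split.
- by move=> c; rewrite /X; pos.
- by move=> c; rewrite /X ler_pdivrMr// ler_pM2l// le_max lexx orbT.
- by move=> c; rewrite /X mulrA ler_pdivrMr// mulrC ler_pM2l ?mulr_gt0// le_max lexx.
- exists (k * tau / Num.max C tau) => [|c cC].
    by rewrite divr_gt0 ?mulr_gt0// lt_max C0.
  rewrite /X ler_pM2l ?mulr_gt0// lef_pV2 ?posrE// ?lt_max ?C0//.
  by rewrite ge_max !le_max cC lexx orbT.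
- move=> c c2.
  have -> : 8 * tau / k = (2 * tau) * (2 * (2 * tau) / (k * tau)).
    by field; rewrite !gt_eqF.
  have -> : 2 / X c = 2 * Num.max `|c| tau / (k * tau).
    by rewrite /X; field; rewrite !gt_eqF.
  rewrite ler_pM//; first by have mc := mx0 c; pos.
  rewrite ler_pM2r ?invr_gt0 ?mulr_gt0// ler_pM2l// ge_max c2/=; lra.
Qed.

(** [tau] and [tau'] are the tolerances for the residual before and after the correction, [k0] caps
    the damping, [n0] counts phases. The last four hypotheses say in turn: the pigeonhole loses
    measure at most [eps / 2]; damping takes at most half of the distance from the phase; the
    Poisson error is at most [tau' / 4]; a block with [|c| <= 2 * tau] is at most [eps / 2]. No
    hypothesis ties [Cb] to [eps]: a large residual only affects the choices of mesh and peak
    function. *)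
Lemma stage (K : set R) (rho : R -> R) (lam : R -> R[i]) (Cb eps tau tau' k0 A r0 : R)
    (n0 : nat) :
  (forall t, K t -> 0 <= t < pi *+ 2) ->
  (forall t, K t -> cnorm (lam t) = 1) ->
  (forall t, K t -> `|rho t| <= Cb) ->
  (forall e : R, 0 < e -> exists2 d : R, 0 < d & forall t t', K t -> K t' ->
     `|t - t'| < d -> `|rho t - rho t'| <= e /\ cnorm (lam t - lam t') <= e) ->
  0 < eps -> 0 < tau -> 0 < tau' -> 0 < k0 -> 0 < A -> 0 <= r0 < 1 ->
  pi *+ 2 < n0%:R * (eps / 2) -> k0 * (4 * n0%:R) <= 1 ->
  16 * (k0 * tau) * (2 * n0%:R) ^+ 2 <= tau' / 4 -> 8 * tau / k0 <= eps / 2 ->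
  exists (f : R[i] -> R[i]) (G : set R),
  [/\ forall z, cnorm z <= 1 -> hol f z,
      cnorm (f 0) <= eps /\ forall z u, cnorm z <= r0 -> cnorm u <= r0 ->
        cnorm (f z - f u) <= eps * cnorm (z - u),
      measurable G /\ (mu G <= eps%:E)%E,
      forall t, K t -> ~ G t -> `|rho t - Re (conjc (lam t) * f (expi t))| <= tau' &
      forall t z, K t -> ~ G t -> `|rho t| <= tau -> cnorm z <= 1 ->
        cnorm (z - expi t) <= A * (1 - cnorm z ^+ 2) -> cnorm (f z) <= eps].
Proof.
move=> K2pi lam1 rhoC unif eps0 tau0 tau'0 k00 A0 r01 npi kn ktau tauk.
pose C := Num.max Cb tau.
have C0 : 0 < C by rewrite lt_max tau0 orbT.
have CbC : Cb <= C by rewrite le_max lexx.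
have tauC : tau <= C by rewrite le_max lexx orbT.
have pi0 := pi_gt0 R.
have n00 : 0 < n0%:R :> R.
  by rewrite -(@pmulr_lgt0 _ (eps / 2)) ?divr_gt0// (lt_trans _ npi)// mulrn_wgt0.
have n0gt : (0 < n0)%N by rewrite -(ltr0n R).
pose sg : R := (2 * n0%:R)^-1.
have sg0 : 0 < sg by rewrite invr_gt0 mulr_gt0.
have k0sg : 2 * k0 <= sg.
  by rewrite -[leRHS]mul1r /sg ler_pdivlMr ?mulr_gt0//; lra.
have sg1 : sg <= 1 / 2.
  rewrite /sg invfM mul1r ler_piMr ?invr_ge0// invf_le1// ler1n.
  exact: n0gt.
have k01 : k0 <= 1 / 4 by lra.
have [X [X0 Xk cX [xm xm0 Xm] small]] := damping C0 tau0 k00.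
pose Q := C * (2 / xm).
have Q0 : 0 < Q by rewrite /Q; pos.
have cQ (c : R) : `|c| <= C -> `|c| * (2 / X c) <= Q.
  move=> cC; rewrite ler_pM//; first by rewrite ltW// divr_gt0.
  by rewrite ler_pM2l// lef_pV2 ?posrE// Xm.
(* The bound [tau' / 4] is for the oscillation of [rho], and [tau] ensures [|c| <= 2 * tau] where
   the residual is at most [tau]. The third bound is for freezing [lam]: the imaginary part of a
   block is uncontrolled, may be as large as [Q], and leaks into the real part through
   [lam t - l i]. *)
pose e := Num.min (Num.min (tau' / 4) tau) (tau' / (4 * Q)).
have e0 : 0 < e.
  by rewrite !lt_min tau0 andbT; apply/andP; split; pos.
have [d d0 hd] := unif e e0.
have e_tau' : e <= tau' / 4 by rewrite !ge_min lexx.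
have e_tau : e <= tau by rewrite !ge_min lexx orbT.
have e_Q : e * Q <= tau' / 4.
  apply: (@le_trans _ _ (tau' / (4 * Q) * Q)).
    by rewrite ler_wpM2r ?(ltW Q0)// !ge_min lexx orbT.
  by rewrite (_ : tau' / (4 * Q) * Q = tau' / 4)//; field; rewrite gt_eqF.
pose N := (Num.bound (pi *+ 2 / d)).+4.
have N0 : 0 < N%:R :> R by rewrite ltr0n.
have Nd : pi *+ 2 / d < N%:R.
  apply: (lt_trans (archi_boundP _)); first by apply: divr_ge0; [rewrite mulrn_wge0// ltW|exact: ltW].
  by rewrite ltr_nat /N; do 3 apply: (ltn_trans (ltnSn _)).
pose h : R := pi / N%:R.
have h0 : 0 < h by rewrite divr_gt0.
have hd2 : 2 * h < d.
  have -> : 2 * h = pi *+ 2 / N%:R by rewrite /h mulr2n; ring.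
  by rewrite ltr_pdivrMr// mulrC -ltr_pdivrMr.
pose del := Num.min (h / 2) (eps / (4 * N%:R)).
have del0 : 0 < del by rewrite lt_min; apply/andP; split; pos.
have delh : del <= h / 2 by rewrite ge_min lexx.
have delN : N%:R * (2 * del) <= eps / 2.
  have : del <= eps / (4 * N%:R) by rewrite ge_min lexx orbT.
  by rewrite ler_pdivlMr ?mulr_gt0//; lra.
(* The [N] blocks off their arcs add up to at most a quarter of either tolerance; the cap [1 / 2] is
   for [cnorm_kern_small] and [kern_lipschitz]. *)
pose e1 := Num.min (1 / 2) (Num.min tau' eps / (16 * N%:R * C)).
have me0 : 0 < Num.min tau' eps by rewrite lt_min tau'0.
have e10 : 0 < e1 by rewrite lt_min; apply/andP; split; pos.
have e12 : e1 <= 1 / 2 by rewrite ge_min lexx.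
have e1N : N%:R * (C * (4 * e1)) <= Num.min tau' eps / 4.
  have : e1 <= Num.min tau' eps / (16 * N%:R * C) by rewrite ge_min lexx orbT.
  by rewrite ler_pdivlMr ?mulr_gt0//; lra.
have min1 : Num.min tau' eps <= tau' by rewrite ge_min lexx.
have min2 : Num.min tau' eps <= eps by rewrite ge_min lexx orbT.
pose s j := arc_mid N j.
have coef (j : nat) : exists cl : R * R[i], [/\ `|cl.1| <= C, cnorm cl.2 = 1 &
    forall t, K t -> `|t - s j| <= h -> `|rho t - cl.1| <= e /\ cnorm (lam t - cl.2) <= e].
  have [[t0 [Kt0 t0j]]|H] := pselect (exists t0, K t0 /\ `|t0 - s j| <= h).
    exists (rho t0, lam t0); split => /=; [|exact: lam1|].
      by rewrite (le_trans (rhoC _ Kt0)).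
    move=> t Kt tj; apply: hd => //; apply: le_lt_trans hd2.
    have -> : t - t0 = (t - s j) - (t0 - s j) by ring.
    by rewrite (le_trans (ler_normB _ _))//; move: tj t0j; clear; lra.
  (* An arc that misses [K] gets the zero block. *)
  exists (0, 1); split; [by rewrite normr0 ltW|exact: cnorm1|].
  by move=> t Kt tj; exfalso; apply: H; exists t.
have [cl hcl] := choice coef.
pose c j := (cl j).1; pose l j := (cl j).2.
have cC j : `|c j| <= C by have [] := hcl j.
have l1 j : cnorm (l j) = 1 by have [] := hcl j.
have near_c j t : K t -> `|t - s j| <= h -> `|rho t - c j| <= e /\ cnorm (lam t - l j) <= e.
  by have [_ _] := hcl j; apply.
have N4 : (4 <= N)%N by [].
have hdpi : 0 <= h - del <= pi.
  have hpi : h <= pi by rewrite /h ler_pdivrMr// ler_peMr ?(ltW pi0)// ler1n.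
  by move: h0 hpi del0 delh; clear; move=> *; apply/andP; split; lra.
have [cosh0 coshd coshd1] := peak_exponents N4 del0 delh.
rewrite -/h in cosh0 coshd coshd1.
have xm14 : xm <= 1 / 4 by rewrite (le_trans _ k01)// (le_trans (Xm _ (cC 0%N))).
have etar : 0 <= 1 - xm < 1.
  by move: xm14 xm0; clear; move=> *; apply/andP; split; lra.
(* One peak function serves all arcs through the rotations [a j]. Its level [1 - xm] is at least
   every [1 - X (c j)], so [W] costs no more modulus on the arc than the damping does. *)
have [W [Whol Wnt Wr Wlip Wpeak]] := peak_fun cosh0 coshd coshd1 A0 r01 e10 etar.
have Whol1 z : cnorm z <= 1 -> hol W z by move=> /Whol[].
have [p [B [p1 mB muB hp]]] := @phase_select N n0 del (eps / 2) W del0 Whol1 npi.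
pose a j : R[i] := conjc (expi (s j)).
have a1 j : cnorm (a j) = 1 by rewrite cnorm_conj cnorm_expi.
pose F j z := (c j)%:C * l j * kern ((1 - X (c j))%:C * (conjc p * W (a j * z))).
have Xr j : 0 <= 1 - X (c j) < 1.
  by move: (X0 (c j)) (Xk (c j)) k01; clear; move=> *; apply/andP; split; lra.
have argE j z : cnorm ((1 - X (c j))%:C * (conjc p * W (a j * z))) =
    (1 - X (c j)) * cnorm (W (a j * z)).
  have /andP[x1 _] := Xr j.
  by rewrite !cnormM cnorm_conj p1 mul1r cnorm_real ger0_norm.
have argW j z : cnorm ((1 - X (c j))%:C * (conjc p * W (a j * z))) <=
    cnorm (W (a j * z)).
  by have /andP[x1 x2] := Xr j; rewrite argE ler_piMl ?cnorm_ge0// ltW.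
have az j z : cnorm (a j * z) = cnorm z by rewrite cnormM a1 mul1r.
have argr j z : cnorm z <= 1 ->
    cnorm ((1 - X (c j))%:C * (conjc p * W (a j * z))) <= 1 - X (c j).
  move=> z1; have /andP[x1 x2] := Xr j; rewrite argE ler_piMr// ltW//.
  by have [] := Whol (a j * z); rewrite ?az.
have FC j z : cnorm (F j z) =
    `|c j| * cnorm (kern ((1 - X (c j))%:C * (conjc p * W (a j * z)))).
  by rewrite /F !cnormM l1 mulr1 cnorm_real.
have F_small j z : cnorm (W (a j * z)) <= e1 -> cnorm (F j z) <= C * (4 * e1).
  move=> hW; rewrite FC ler_pM ?cnorm_ge0//.
  by rewrite cnorm_kern_small// (le_trans (argW _ _)).
have F_big j z : cnorm z <= 1 -> cnorm (F j z) <= `|c j| * (2 / X (c j)).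
  move=> z1; rewrite FC ler_wpM2l//.
  have /andP[x1 x2] := Xr j; rewrite (le_trans (cnorm_kern (argr j z z1) x2))//.
  rewrite opprB addrCA subrr addr0 ler_pM2r ?invr_gt0//.
  by move: (X0 (c j)); clear; lra.
have [mE muE] := @measure_edges N s h del del0.
set E := (X in measurable X) in mE; rewrite -/E in muE.
exists (fun z => \sum_(j < N) F j z), (B `|` E).
have locate t : K t -> ~ (B `|` E) t -> exists i : 'I_N,
    `|t - s i| <= h - del /\ sg <= cnorm (p - W (a i * expi t)).
  move=> Kt nG; have [i ti] := @arc_index _ N t isT (K2pi t Kt).
  have ti' : `|t - s i| <= h - del.
    rewrite leNgt; apply/negP => ti2; apply: nG; right.
    apply/(mem_bigsetU N (fun j => `[s j - h, s j - h + del]%classic `|`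
      `[s j + h - del, s j + h]%classic)); exists (nat_of_ord i) => //=.
    move: ti ti2; rewrite -/(arc_mid N i) -/(s i) -/h.
    by clear; exact: in_edge.
  by exists i; split => //; apply: hp => // Bt; apply: nG; left.
have off t (i j : 'I_N) z : `|t - s i| <= h - del -> j != i -> cnorm z <= 1 ->
    cnorm (z - expi t) <= A * (1 - cnorm z ^+ 2) -> cnorm (F j z) <= C * (4 * e1).
  move=> ti ji z1 hz; apply: F_small; apply: (Wnt (a j * expi t)).
  - by rewrite az cnorm_expi.
  - rewrite Re_conj_expi_mul; apply: (@cos_other_arc _ i) => //.
    by rewrite (le_trans ti)// gerBl ltW.
  - by rewrite az.
  - by rewrite -mulrBr !az.
split.
- move=> z z1; apply: hol_sum => j.
  apply: holM; first exact: hol_cst.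
  apply: (@hol_comp _ (fun z => (1 - X (c j))%:C * (conjc p * W (a j * z))) (@kern R)).
    apply: holM; first exact: hol_cst.
    apply: holM; first exact: hol_cst.
    apply: (@hol_comp _ (fun z => a j * z) W); last by apply: Whol1; rewrite az.
    by apply: holM; [exact: hol_cst|exact: hol_id].
  apply: hol_kern; rewrite (le_lt_trans (argr j z z1))//.
  by have /andP[] := Xr j.
- split.
    rewrite (le_trans (@sum_le_card _ _ _ (C * (4 * e1)) _))//; last by move: e1N min2 eps0; clear; lra.
    by move=> j; apply: F_small; rewrite mulr0; apply: Wr; rewrite cnorm0; case/andP: r01.
  move=> z u zr ur; rewrite -sumrB.
  apply: le_trans (sum_le_card (B := C * (8 * (e1 * cnorm (z - u)))) _) _.
    move=> j; rewrite /F -mulrBr !cnormM l1 mulr1 cnorm_real ler_pM ?cnorm_ge0//.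
    have hz v : cnorm v <= r0 -> cnorm (W (a j * v)) <= 1 / 2.
      by move=> vr; rewrite (le_trans _ e12)// Wr ?az.
    rewrite (le_trans (kern_lipschitz _ _))//.
    + by rewrite (le_trans (argW _ _))// hz.
    + by rewrite (le_trans (argW _ _))// hz.
    rewrite ler_pM2l// -mulrBr -mulrBr !cnormM cnorm_conj p1 mul1r cnorm_real.
    have /andP[x1 x2] := Xr j; rewrite ger0_norm//.
    rewrite (@le_trans _ _ (cnorm (W (a j * z) - W (a j * u))))//.
      by rewrite ler_piMl ?cnorm_ge0// ltW.
    rewrite (le_trans (Wlip _ _ _ _)) ?az//.
    by rewrite -mulrBr az.
  have -> : N%:R * (C * (8 * (e1 * cnorm (z - u)))) =
    2 * (N%:R * (C * (4 * e1))) * cnorm (z - u) by ring.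
  by rewrite ler_wpM2r ?cnorm_ge0//; move: e1N min2 eps0; clear; lra.
- split; first exact: measurableU.
  rewrite (le_trans (measureU2 _ _ _))//.
  apply: le_trans (leeD muB muE) _.
  by rewrite -EFinD lee_fin; move: delN; clear; lra.
- move=> t Kt nG; have [i [ti hW]] := locate t Kt nG.
  have et1 : cnorm (expi t) <= 1 by rewrite cnorm_expi.
  have tih : `|t - s i| <= h by rewrite (le_trans ti)// gerBl ltW.
  have [h_rho h_lam] := near_c i t Kt tih.
  pose v := (1 - X (c i))%:C * (conjc p * W (a i * expi t)).
  have hrest : cnorm (\sum_(j < N) F j (expi t) - F i (expi t)) <= N%:R * (C * (4 * e1)).
    apply: sum_offdiag => [|j ji]; first by pos.
    apply: (off t i) => //; rewrite subrr cnorm0 mulr_ge0 ?(ltW A0)//.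
    exact: le_unit_sub_sqr.
  have hv : `|1 - Re (kern v)| <= 16 * X (c i) / sg ^+ 2.
    have /andP[x1 x2] := Xr i.
    apply: kern_near_circle => //; [exact: ltW|by rewrite (le_lt_trans (argr _ _ et1))| |].
      have : 1 - xm <= cnorm (W (a i * expi t)).
        apply: Wpeak; first by rewrite az cnorm_expi.
        by rewrite Re_conj_expi_mul; exact: (cos_same_arc hdpi).
      have := Xm _ (cC i); rewrite argE => hx hw.
      have : (1 - X (c i)) * (1 - X (c i)) <= (1 - X (c i)) * cnorm (W (a i * expi t)).
        by rewrite ler_wpM2l//; move: hx hw; clear; lra.
      by move: (sqr_ge0 (X (c i))); clear; lra.
    have w1 : cnorm (W (a i * expi t)) <= 1.
      by rewrite ltW//; have [] := Whol (a i * expi t); rewrite ?az.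
    have hpw : sg <= cnorm (1 - conjc p * W (a i * expi t)).
      rewrite -(conjM_cnorm1 p1) -mulrBr cnormM cnorm_conj p1 mul1r//.
    (* Damping moves the point by at most [X (c i) <= k0 <= sg / 2], which leaves half of the
       separation. *)
    have -> : 1 - v = (1 - conjc p * W (a i * expi t)) +
        (X (c i))%:C * (conjc p * W (a i * expi t)).
      by rewrite /v rmorphB rmorph1; ring.
    have := cdistB (1 - conjc p * W (a i * expi t))
      (- ((X (c i))%:C * (conjc p * W (a i * expi t)))).
    rewrite opprK cnormN !cnormM cnorm_conj p1 mul1r cnorm_real gtr0_norm//.
    have : X (c i) * cnorm (W (a i * expi t)) <= X (c i) by rewrite ler_piMr// ltW.
    by move: (Xk (c i)) k0sg hpw; clear; lra.
  (* Four errors of at most [tau' / 4] each: oscillation of [rho], the Poisson kernel, freezing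
     [lam], and the blocks of the other arcs. *)
  have E1 : rho t - Re (conjc (lam t) * \sum_(j < N) F j (expi t)) =
      (rho t - c i) + c i * (1 - Re (kern v)) -
      Re ((conjc (lam t) - conjc (l i)) * F i (expi t)) -
      Re (conjc (lam t) * (\sum_(j < N) F j (expi t) - F i (expi t))).
    have E2 : conjc (lam t) * \sum_(j < N) F j (expi t) = (c i)%:C * kern v +
        (conjc (lam t) - conjc (l i)) * F i (expi t) +
        conjc (lam t) * (\sum_(j < N) F j (expi t) - F i (expi t)).
      have -> : (c i)%:C * kern v = conjc (l i) * F i (expi t).
        rewrite /F -/v mulrA [conjc _ * (_ * _)]mulrCA conjM_cnorm1 ?mulr1//.
      by ring.
    have E3 : Re ((c i)%:C * kern v) = c i * Re (kern v).
      by rewrite cReM /= mul0r subr0.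
    by rewrite E2 cReD cReD E3; ring.
  rewrite E1 (le_trans (ler_normB _ _))//.
  have b4 : `|Re (conjc (lam t) * (\sum_(j < N) F j (expi t) - F i (expi t)))| <= tau' / 4.
    rewrite (le_trans (normr_Re _))// cnormM cnorm_conj lam1// mul1r.
    by rewrite (le_trans hrest)//; move: e1N min1; clear; lra.
  have b3 : `|Re ((conjc (lam t) - conjc (l i)) * F i (expi t))| <= tau' / 4.
    rewrite (le_trans (normr_Re _))// cnormM -rmorphB cnorm_conj.
    rewrite (le_trans _ e_Q)// ler_pM ?cnorm_ge0//.
    by rewrite (le_trans (F_big i _ et1))// cQ.
  have b2 : `|c i * (1 - Re (kern v))| <= tau' / 4.
    rewrite normrM (le_trans (ler_wpM2l (normr_ge0 _) hv))//.
    apply: le_trans ktau.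
    have -> : `|c i| * (16 * X (c i) / sg ^+ 2) =
        16 * (`|c i| * X (c i)) * (2 * n0%:R) ^+ 2.
      by rewrite /sg exprVn invrK; ring.
    by rewrite ler_wpM2r ?sqr_ge0// ler_pM2l.
  have b12 : `|rho t - c i + c i * (1 - Re (kern v))| <= tau' / 4 + tau' / 4.
    by rewrite (le_trans (ler_normD _ _))// lerD// (le_trans h_rho).
  have := ler_normB (rho t - c i + c i * (1 - Re (kern v)))
    (Re ((conjc (lam t) - conjc (l i)) * F i (expi t))).
  by move: b12 b3 b4; clear; lra.
- move=> t z Kt nG rt z1 hz; have [i [ti _]] := locate t Kt nG.
  have tih : `|t - s i| <= h by rewrite (le_trans ti)// gerBl ltW.
  have [h_rho _] := near_c i t Kt tih.
  have ci : `|c i| <= 2 * tau.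
    have -> : c i = rho t - (rho t - c i) by ring.
    by rewrite (le_trans (ler_normB _ _))//; move: rt h_rho e_tau; clear; lra.
  have hrest : cnorm (\sum_(j < N) F j z - F i z) <= N%:R * (C * (4 * e1)).
    by apply: sum_offdiag => [|j ji]; [pos|apply: (off t i)].
  have hi : cnorm (F i z) <= eps / 2.
    by rewrite (le_trans (F_big i z z1))// (le_trans (small _ ci)).
  rewrite -(subrK (F i z) (\sum_(j < N) F j z)) (le_trans (cnormD _ _))//.
  by move: hi hrest e1N min2 eps0; clear; lra.
Qed.

End Stage.

(** * Borel representatives, Lusin sets and uniform continuity *)

Section BorelLusin.
Variable R : realType.
Implicit Types (t x : R) (D K : set R) (u f : R -> R).
Local Notation mu := (@lebesgue_measure R).

(** Only the countably many superlevel sets at rational heights need a null correction, so one Borel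
    null set suffices; any other superlevel set is a union of these. *)
Lemma borel_reduction D u : measurable D -> lebesgue_measurable_fun D u ->
  exists Z : set R, [/\ measurable Z, mu Z = 0 & measurable_fun (D `\` Z) u].
Proof.
(* An enumeration of the rationals; indices that code nothing repeat the value 0. *)
move=> mD hu; pose q n : R := ratr (odflt (0 : rat) (unpickle n)).
pose X n := D `&` u @^-1` `]q n, +oo[%classic.
have H n : exists AM : set R * set R, [/\ measurable AM.1, measurable AM.2, mu AM.2 = 0 &
    AM.1 `<=` X n /\ X n `<=` AM.1 `|` AM.2].
  have [A mA [N [M [mM M0 NM]] E]] := hu `]q n, +oo[%classic (measurable_itv _).
  exists (A, M); split => //=; rewrite /X -E; split => t; first by left.
  by case=> [|/NM]; [left|right].
have [AM hAM] := choice H.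
pose Z := \bigcup_n (AM n).2.
have mZ : measurable Z by apply: bigcupT_measurable => n; have [] := hAM n.
have Z0 : mu Z = 0.
  apply: measure_negligible => //; apply: negligible_bigcup => n.
  by have [_ m2 m0 _] := hAM n; exists (AM n).2; split.
exists Z; split => //; apply: (measurability (@RGenOInfty.G R)).
  exact: RGenOInfty.measurableE.
move=> _ [_ [x ->] <-].
have -> : (D `\` Z) `&` u @^-1` `]x, +oo[%classic =
    \bigcup_n (if x < q n then (AM n).1 `\` Z else set0).
  apply/seteqP; split => t.
    move=> [[Dt Zt]]; rewrite /= in_itv/= andbT => xu.
    have [r] := rat_in_itvoo xu; rewrite in_itv/= => /andP[xr ru].
    exists (pickle r) => //; rewrite /q pickleK /= xr; split => //.
    have [_ _ _ [_ h]] := hAM (pickle r).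
    have : X (pickle r) t by split => //; rewrite /= in_itv/= andbT /q pickleK.
    by move=> /h[//|ht]; exfalso; apply: Zt; exists (pickle r).
  move=> [n _]; case: ifP => // xq [At Zt].
  have [_ _ _ [h _]] := hAM n; have [Dt] := h _ At.
  rewrite /= in_itv/= andbT => qu; split => //.
  by rewrite /= in_itv/= andbT (lt_trans xq).
apply: bigcupT_measurable => n; case: ifP => // _; apply: measurableD => //.
by have [] := hAM n.
Qed.

Lemma lusin3 D (f1 f2 f3 : R -> R) (e : R) : measurable D -> (mu D < +oo)%E -> 0 < e ->
  measurable_fun D f1 -> measurable_fun D f2 -> measurable_fun D f3 ->
  exists K, [/\ compact K, K `<=` D, measurable K, (mu (D `\` K) <= e%:E)%E &
    [/\ {within K, continuous f1}, {within K, continuous f2} &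
        {within K, continuous f3}]].
Proof.
move=> mD Dfin e0 m1 m2 m3.
have e3 : 0 < e / 3 by rewrite divr_gt0.
have [K1 [c1 s1 mu1 h1]] := measurable_almost_continuous mD Dfin e3 m1.
have [K2 [c2 s2 mu2 h2]] := measurable_almost_continuous mD Dfin e3 m2.
have [K3 [c3 s3 mu3 h3]] := measurable_almost_continuous mD Dfin e3 m3.
have cl (K : set R) : compact K -> closed K by apply: compact_closed; exact: Rhausdorff.
have clK : closed (K1 `&` K2 `&` K3) by apply: closedI; [apply: closedI|]; exact: cl.
have mc (K : set R) : compact K -> measurable K by move=> /cl; exact: closed_measurable.
have S1 : K1 `&` K2 `&` K3 `<=` K1 by move=> t [[]].
exists (K1 `&` K2 `&` K3); split.
- exact: (subclosed_compact clK c1 S1).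
- by move=> t /S1 /s1.
- exact: closed_measurable.
- have m' (K : set R) : compact K -> measurable (D `\` K) by move=> /mc; exact: measurableD.
  rewrite !setDIr; apply: (le_trans (measureU2 _ _ _)).
  + by apply: measurableU; exact: m'.
  + exact: m'.
  have -> : e = e / 3 + e / 3 + e / 3 by lra.
  rewrite !EFinD; apply: leeD; last exact: ltW.
  apply: (le_trans (measureU2 _ _ _)); [exact: m'|exact: m'|].
  by apply: leeD; exact: ltW.
- split; [exact: (continuous_subspaceW S1)|
    apply: continuous_subspaceW h2 => t [[]]|apply: continuous_subspaceW h3 => t []] => //.
Qed.

Lemma within_continuous_dist K f x (e : R) : {within K, continuous f} -> K x -> 0 < e ->
  exists2 d : R, 0 < d & forall t, K t -> `|x - t| < d -> `|f x - f t| < e.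
Proof.
move=> /subspace_continuousP/(_ x) h Kx e0.
have /cvgrPdist_lt/(_ e e0) := h Kx; rewrite /within/= => /nbhs_ballP[d /= d0 hd].
by exists d => // t Kt tx; apply: hd.
Qed.

Lemma compact_uniform K f : compact K -> {within K, continuous f} ->
  (exists C : R, forall t, K t -> `|f t| <= C) /\
  forall e : R, 0 < e -> exists2 d : R, 0 < d & forall t t', K t -> K t' ->
    `|t - t'| < d -> `|f t - f t'| <= e.
Proof.
move=> cK cf; split.
  have [M [_ hM]] := compact_bounded (continuous_compact cf cK).
  exists (M + 1) => t Kt; apply: (hM (M + 1)); first by rewrite ltrDl.
  by exists t.
move=> e e0; have e20 : 0 < e / 2 by rewrite divr_gt0.
(* The near-covering form of compactness, for the filter of small [d > 0], merges the local moduli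
   of continuity into a uniform one. *)
move/compact_near_coveringP: cK => /(_ R (0^'+) (fun d t => forall t', K t -> K t' ->
  `|t - t'| < d -> `|f t - f t'| <= e) _) H.
have : \forall d \near 0^'+, K `<=` (fun t => forall t', K t -> K t' ->
    `|t - t'| < d -> `|f t - f t'| <= e).
  apply: H => x Kx; have [r r0 hr] := within_continuous_dist cf Kx e20.
  have r20 : 0 < r / 2 by rewrite divr_gt0.
  near=> t d => /= t' Kt Kt' tt'.
  have xt : `|x - t| < r / 2 by near: t; exact: nbhsx_ballx.
  have dr : d < r / 2 by near: d; exact: nbhs_right_lt.
  have h1 : `|f x - f t| < e / 2 by apply: hr => //; lra.
  have h2 : `|f x - f t'| < e / 2.
    apply: hr => //; rewrite (le_lt_trans (ler_distD t _ _))//; lra.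
  by rewrite (le_trans (ler_distD (f x) _ _))// [X in X + _]distrC; lra.
move=> hd; near (0 : R)^'+ => d.
exists d => // t t' Kt Kt' tt'.
by have := near hd d; apply.
Unshelve. all: by end_near.
Qed.

Lemma continuous_hol_expi (S : R[i] -> R[i]) : (forall z, cnorm z <= 1 -> hol S z) ->
  continuous (fun t : R => Re (S (expi t))) /\ continuous (fun t : R => Im (S (expi t))).
Proof.
move=> hS.
have H t (e : R) : 0 < e -> \forall u \near t, cnorm (S (expi t) - S (expi u)) < e.
  move=> e0.
  have := @open_hol_expi R S 1 (S (expi t)) e (cnorm1 R) hS.
  rewrite openE => /(_ t) /=; rewrite !mul1r subrr cnorm0 => /(_ e0).
  rewrite /interior /=; apply: filterS => u /=.
  by rewrite mul1r.
split=> t; apply/cvgrPdist_lt => e e0; apply: filterS (H t e e0) => u.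
  by apply: le_lt_trans; rewrite -cReB normr_Re.
by apply: le_lt_trans; rewrite -cImB normr_Im.
Qed.

End BorelLusin.

(** * Limits of geometrically convergent sequences *)

Section GeometricLimits.
Variable R : realType.
Implicit Types (z w : R[i]).

(** A total operation reducing convergence to two real sequences; its value is meaningful where both
    converge. *)
Definition climit (u : nat -> R[i]) : R[i] :=
  Complex (limn (fun n => Re (u n))) (limn (fun n => Im (u n))).

Lemma half_exp_small (e : R) : 0 < e -> exists n, (1 / 2) ^+ n <= e.
Proof.
move=> e0; have q01 : 0 <= (1 / 2 : R) < 1 by apply/andP; split; lra.
by have [n [_ h]] := natmul_exp_small q01 e0; exists n.+1.
Qed.

Lemma half_exp_gt0 n : 0 < (1 / 2 : R) ^+ n.
Proof. by rewrite exprn_gt0. Qed.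

Lemma half_exp_le n m : (n <= m)%N -> (1 / 2 : R) ^+ m <= (1 / 2) ^+ n.
Proof. by move=> nm; apply: ler_wiXn2l => //; lra. Qed.

Lemma geometric_limit (u : nat -> R) M (B : R) : 0 <= B ->
  (forall n, (M <= n)%N -> `|u n.+1 - u n| <= B * (1 / 2) ^+ n) ->
  forall n, (M <= n)%N -> `|limn u - u n| <= 2 * B * (1 / 2) ^+ n.
Proof.
move=> B0 hu.
(* The subtracted term closes the induction: [B * (1 / 2) ^+ m] is exactly the difference of two
   consecutive tails. *)
have step n k : (M <= n)%N ->
    `|u (n + k)%N - u n| <= 2 * B * (1 / 2) ^+ n - 2 * B * (1 / 2) ^+ (n + k).
  move=> Mn; elim: k => [|k IH]; first by rewrite addn0 !subrr normr0.
  rewrite (le_trans (ler_distD (u (n + k)%N) _ _))// addnS exprS.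
  by have := hu (n + k)%N (leq_trans Mn (leq_addr _ _)); lra.
have bnd n m : (M <= n)%N -> (n <= m)%N -> `|u m - u n| <= 2 * B * (1 / 2) ^+ n.
  move=> Mn nm; have := step n (m - n)%N Mn; rewrite subnKC// => h.
  by rewrite (le_trans h)// gerBl mulr_ge0 ?mulr_ge0// ltW ?half_exp_gt0.
have cu : cvgn u.
  apply/cauchy_cvgP/cauchy_exP => e e0.
  have e1 : 0 < e / (2 * B + 1) by rewrite divr_gt0//; lra.
  have [n hn] := half_exp_small e1.
  exists (u (maxn M n)).
  exists (maxn M n) => // m /= nm; rewrite /ball /= distrC.
  apply: le_lt_trans (bnd _ _ (leq_maxl _ _) nm) _.
  have h : (1 / 2) ^+ maxn M n <= e / (2 * B + 1).
    by rewrite (le_trans (half_exp_le (leq_maxr M n))).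
  move: h; rewrite ler_pdivlMr; last by lra.
  by have := half_exp_gt0 (maxn M n); lra.
move=> n Mn; rewrite ler_distl; apply/andP; split.
  apply: limr_ge => //; near=> m.
  by have := bnd n m Mn (_ : (n <= m)%N); rewrite ler_distl => /(_ _)/andP[|//]; near: m; exact: nbhs_infty_ge.
apply: limr_le => //; near=> m.
by have := bnd n m Mn (_ : (n <= m)%N); rewrite ler_distl => /(_ _)/andP[|//]; near: m; exact: nbhs_infty_ge.
Unshelve. all: by end_near.
Qed.

Lemma climit_geometric (u : nat -> R[i]) M (B : R) : 0 <= B ->
  (forall n, (M <= n)%N -> cnorm (u n.+1 - u n) <= B * (1 / 2) ^+ n) ->
  forall n, (M <= n)%N -> cnorm (climit u - u n) <= 4 * B * (1 / 2) ^+ n.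
Proof.
move=> B0 hu n Mn; rewrite (le_trans (cnorm_le_ReIm _))// cReB cImB /=.
have h1 := @geometric_limit (fun n => Re (u n)) M B B0 _ n Mn.
have h2 := @geometric_limit (fun n => Im (u n)) M B B0 _ n Mn.
have -> : 4 * B * (1 / 2) ^+ n = 2 * B * (1 / 2) ^+ n + 2 * B * (1 / 2) ^+ n :> R by lra.
apply: lerD; [apply: h1|apply: h2] => m Mm; rewrite -?cReB -?cImB;
  apply: le_trans (hu m Mm); [exact: normr_Re|exact: normr_Im].
Qed.

Lemma hol_quotient (f : R[i] -> R[i]) z : hol f z -> exists a : R[i],
  forall e : R, 0 < e -> exists2 d : R, 0 < d & forall u, u != z ->
     cnorm (u - z) < d -> cnorm ((f u - f z) / (u - z) - a) < e.
Proof.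
move=> /cvg_ex[/= a ha]; exists a => e e0.
have /cvg_complexP/(_ e e0) := ha; rewrite /dnbhs /within /=.
move=> /nbhs_complexP[d d0 hd]; exists d => // u uz ud.
have := hd (u - z); rewrite subr0 => /(_ ud); rewrite subr_eq0 => /(_ uz).
by rewrite [(u - z) *: _]mulr1 subrK [_ *: _]mulrC.
Qed.

(* Lipschitz bounds on the increments make the difference quotients converge uniformly, which avoids
   Weierstrass' theorem and Cauchy's formula. *)
Lemma hol_climit (S : nat -> R[i] -> R[i]) (r : R) M z : cnorm z < r ->
  (forall n, hol (S n) z) ->
  (forall n u, (M <= n)%N -> cnorm u <= r -> exists2 B : R, 0 <= B &
     forall m, (n <= m)%N -> cnorm (S m.+1 u - S m u) <= B * (1 / 2) ^+ m) ->
  (forall n u v, (M <= n)%N -> cnorm u <= r -> cnorm v <= r ->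
     cnorm ((S n.+1 u - S n u) - (S n.+1 v - S n v)) <= (1 / 2) ^+ n * cnorm (u - v)) ->
  hol (fun u => climit (fun n => S n u)) z.
Proof.
move=> zr hS Sc Sl; set f := fun u => _.
have zr' : cnorm z <= r by exact: ltW.
have tail n u v : (M <= n)%N -> cnorm u <= r -> cnorm v <= r ->
    cnorm ((f u - f v) - (S n u - S n v)) <= 2 * cnorm (u - v) * (1 / 2) ^+ n.
  move=> Mn ur vr.
  have step k : cnorm ((S (n + k)%N u - S (n + k)%N v) - (S n u - S n v)) <=
      2 * cnorm (u - v) * (1 / 2) ^+ n - 2 * cnorm (u - v) * (1 / 2) ^+ (n + k).
    elim: k => [|k IH]; first by rewrite addn0 !subrr cnorm0.
    rewrite (le_trans (cdist_triangle (S (n + k)%N u - S (n + k)%N v) _ _))//.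
    have := Sl (n + k)%N u v (leq_trans Mn (leq_addr _ _)) ur vr.
    rewrite addnS exprS.
    have -> : S (n + k).+1 u - S (n + k).+1 v - (S (n + k)%N u - S (n + k)%N v) =
      S (n + k).+1 u - S (n + k)%N u - (S (n + k).+1 v - S (n + k)%N v) by ring.
    by lra.
  have [Bu Bu0 hu] := Sc n u Mn ur; have [Bv Bv0 hv] := Sc n v Mn vr.
  apply/ler_addgt0Pr => e e0.
  have e1 : 0 < e / (4 * Bu + 4 * Bv + 1) by rewrite divr_gt0//; lra.
  have [k hk] := half_exp_small e1.
  have nk : (n <= n + k)%N by exact: leq_addr.
  have gu := climit_geometric Bu0 hu nk; have gv := climit_geometric Bv0 hv nk.
  rewrite -/(f u) in gu; rewrite -/(f v) in gv.
  have hk' : (1 / 2) ^+ (n + k) <= e / (4 * Bu + 4 * Bv + 1).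
    by rewrite (le_trans (half_exp_le (leq_addl n k))).
  rewrite ler_pdivlMr in hk'; last by lra.
  have -> : f u - f v - (S n u - S n v) = (f u - S (n + k)%N u) - (f v - S (n + k)%N v)
    + ((S (n + k)%N u - S (n + k)%N v) - (S n u - S n v)) by ring.
  rewrite (le_trans (cnormD _ _))//.
  have h1 := cnormB (f u - S (n + k)%N u) (f v - S (n + k)%N v).
  have h2 := step k.
  have h3 : 0 <= 2 * cnorm (u - v) * (1 / 2) ^+ (n + k).
    by rewrite !mulr_ge0 ?cnorm_ge0// ltW ?half_exp_gt0.
  have h4 := half_exp_gt0 (n + k).
  by move: gu gv h1 h2 h3 h4 hk'; clear; lra.
have [A hA] := choice (fun n => hol_quotient (hS n)).
have [A' A'P] : exists A', forall n, (M <= n)%N ->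
    cnorm (A' - A n) <= 4 * 2 * (1 / 2) ^+ n.
  exists (climit A); apply: climit_geometric => // n Mn.
  apply/ler_addgt0Pr => e e0; have e2 : 0 < e / 2 by rewrite divr_gt0.
  have [d1 d10 h1] := hA n (e / 2) e2; have [d2 d20 h2] := hA n.+1 (e / 2) e2.
  have rz : 0 < r - cnorm z by rewrite subr_gt0.
  (* Consecutive derivatives are compared at a single point [u = z + d], near enough for both
     difference quotients and still within radius [r]. *)
  pose d := Num.min (Num.min d1 d2) (r - cnorm z) / 2.
  have d0 : 0 < d by rewrite divr_gt0// !lt_min d10 d20.
  pose u := z + real_complex R d.
  have uz : u - z = real_complex R d by rewrite /u addrC addKr.
  have uzd : cnorm (u - z) = d by rewrite uz cnorm_real gtr0_norm.
  have uz0 : u != z by rewrite -subr_eq0 -cnorm_gt0 uzd.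
  have dm : d < Num.min (Num.min d1 d2) (r - cnorm z).
    by rewrite /d ltr_pdivrMr// ltr_pMr ?ltr1n// !lt_min d10 d20.
  move: dm; rewrite !lt_min => /andP[/andP[dd1 dd2] dr].
  have ur : cnorm u <= r by rewrite (le_trans (cnormD _ _))// cnorm_real gtr0_norm//; lra.
  have q1 := h1 u uz0; have q2 := h2 u uz0; rewrite uzd in q1 q2.
  have {}q1 := q1 dd1; have {}q2 := q2 dd2.
  have q3 : cnorm ((S n.+1 u - S n.+1 z) / (u - z) - (S n u - S n z) / (u - z)) <=
      (1 / 2) ^+ n.
    rewrite -mulrBl cnormM cnormV uzd ler_pdivrMr//.
    have := Sl n u z Mn ur zr'; rewrite uzd.
    by have -> : S n.+1 u - S n u - (S n.+1 z - S n z) =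
      S n.+1 u - S n.+1 z - (S n u - S n z) by ring.
  have t1 := cdist_triangle ((S n.+1 u - S n.+1 z) / (u - z)) (A n.+1) (A n).
  have t2 := cdist_triangle ((S n u - S n z) / (u - z)) ((S n.+1 u - S n.+1 z) / (u - z)) (A n).
  rewrite cdistC in q2.
  by have := half_exp_gt0 n; move: q1 q2 q3 t1 t2; clear; lra.
apply: (hol_of_quotient (a := A')) => e e0.
have e16 : 0 < e / 16 by rewrite divr_gt0.
have [k hk] := half_exp_small e16.
pose n := maxn M k.
have Mn : (M <= n)%N by exact: leq_maxl.
have hn : (1 / 2) ^+ n <= e / 16 by rewrite (le_trans (half_exp_le (leq_maxr M k))).
have [d d0 hd] := hA n (e / 4) (divr_gt0 e0 (ltr0n _ 4)).
have rz : 0 < r - cnorm z by rewrite subr_gt0.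
exists (Num.min d (r - cnorm z)); first by rewrite lt_min d0.
move=> u uz; rewrite lt_min => /andP[ud ur].
have ur' : cnorm u <= r.
  by rewrite -(subrK z u) (le_trans (cnormD _ _))//; lra.
have uz0 : 0 < cnorm (u - z) by rewrite cnorm_gt0 subr_eq0.
have q1 := hd u uz ud; have q2 := A'P n Mn.
have q3 : cnorm ((f u - f z) / (u - z) - (S n u - S n z) / (u - z)) <= 2 * (1 / 2) ^+ n.
  rewrite -mulrBl cnormM cnormV ler_pdivrMr//.
  by rewrite (le_trans (tail n u z Mn ur' zr'))// mulrAC.
have t1 := cdist_triangle ((S n u - S n z) / (u - z)) ((f u - f z) / (u - z)) A'.
have t2 := cdist_triangle (A n) ((S n u - S n z) / (u - z)) A'.
rewrite cdistC in q2.
by move: q1 q2 q3 t1 t2 hn e0; clear; lra.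
Qed.

End GeometricLimits.

(** * Iteration of the stages and nontangential limits *)

Section Assembly.
Variable R : realType.
Implicit Types (z w : R[i]) (t : R).
Local Notation mu := (@lebesgue_measure R).
Local Notation x_ n := ((1 / 2 : R) ^+ n).

(** With [w = 1 - conjc zeta * z] one has [|z - zeta| = |w|] and [1 - |z|^2 = 2 * Re w - |w|^2]. The
    sector gives [|w| <= (1 + tan theta) * Re w]; closeness to [zeta] then gives [|w|^2 <= Re w],
    hence [Re w <= 1 - |z|^2]. *)
Lemma stolz_of_arg (zeta z : R[i]) (theta : R) : cnorm zeta = 1 ->
  theta < pi / 2 -> 0 < Re (1 - conjc zeta * z) ->
  `|arg_rhp (1 - conjc zeta * z)| < theta ->
  cnorm (z - zeta) * (1 + tan theta) <= 1 ->
  0 < 1 + tan theta /\ cnorm (z - zeta) <= (1 + tan theta) * (1 - cnorm z ^+ 2).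
Proof.
move=> zeta1 th2; set w := 1 - conjc zeta * z => w0 warg.
have th0 : 0 < theta by rewrite (le_lt_trans _ warg).
have pi0 := pi_gt0 R.
have in_th (x : R) : - theta <= x -> x <= theta -> x \in `]- (pi / 2), pi / 2[.
  by move=> *; rewrite in_itv/=; apply/andP; split; lra.
have thI : theta \in `]- (pi / 2), pi / 2[ by apply: in_th; lra.
have nthI : - theta \in `]- (pi / 2), pi / 2[ by apply: in_th; lra.
move: warg; rewrite /arg_rhp ltr_norml => /andP[a1 a2].
have aI : atan (Im w / Re w) \in `]- (pi / 2), pi / 2[ by apply: in_th; lra.
have b1 : Im w / Re w < tan theta by rewrite -[ltLHS]atanK ltr_tan.
have b2 : - tan theta < Im w / Re w by rewrite -tanN -[ltRHS]atanK ltr_tan.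
have T0 : 0 < tan theta by lra.
have Im_le : `|Im w| <= tan theta * Re w.
  have c1 : Im w < tan theta * Re w by rewrite -ltr_pdivrMr.
  have c2 : - tan theta * Re w < Im w by rewrite -ltr_pdivlMr.
  by rewrite ler_norml -mulNr !ltW.
have wE : cnorm (z - zeta) = cnorm w.
  have -> : w = conjc zeta * (zeta - z) by rewrite mulrBr conjM_cnorm1.
  by rewrite cnormM cnorm_conj zeta1 mul1r cdistC.
have zE : 1 - cnorm z ^+ 2 = 2 * Re w - cnorm w ^+ 2.
  have -> : cnorm z = cnorm (1 - w).
    have -> : 1 - w = conjc zeta * z by rewrite /w; ring.
    by rewrite cnormM cnorm_conj zeta1 mul1r.
  by rewrite !cnorm_sqr cReB cImB /=; ring.
have wle : cnorm w <= (1 + tan theta) * Re w.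
  rewrite (le_trans (cnorm_le_ReIm w))// (gtr0_norm w0) mulrDl mul1r.
  by rewrite lerD2l.
rewrite wE zE => small; split; first by lra.
have h1 : cnorm w * (cnorm w * (1 + tan theta)) <= cnorm w * 1.
  by rewrite ler_wpM2l ?cnorm_ge0.
apply: (le_trans wle); rewrite ler_pM2l; last by lra.
have h2 : cnorm w * cnorm w * (1 + tan theta) <= Re w * (1 + tan theta).
  by rewrite -mulrA (le_trans h1)// mulr1 mulrC.
rewrite ler_pM2r in h2; last by lra.
by rewrite expr2; lra.
Qed.

Lemma residual_uniform (K : set R) (phi : R -> R) (lam S : R -> R[i]) :
  compact K -> {within K, continuous phi} ->
  {within K, continuous (fun t => Re (lam t))} ->
  {within K, continuous (fun t => Im (lam t))} ->
  continuous (fun t => Re (S t)) -> continuous (fun t => Im (S t)) ->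
  let rho t := phi t - Re (conjc (lam t) * S t) in
  (exists C : R, forall t, K t -> `|rho t| <= C) /\
  forall e : R, 0 < e -> exists2 d : R, 0 < d & forall t t', K t -> K t' ->
     `|t - t'| < d -> `|rho t - rho t'| <= e /\ cnorm (lam t - lam t') <= e.
Proof.
move=> cK cphi cRe cIm cSr cSi rho.
have crho : {within K, continuous rho}.
  have -> : rho = (fun t => phi t - (Re (lam t) * Re (S t) + Im (lam t) * Im (S t))).
    apply/funext => t; rewrite /rho cReM; congr (_ - _).
    by case: (lam t) => a b; case: (S t) => c d /=; ring.
  have wr : {within K, continuous (fun t => Re (S t))} by exact: continuous_subspaceT.
  have wi : {within K, continuous (fun t => Im (S t))} by exact: continuous_subspaceT.
  move=> t; apply: cvgB; first exact: cphi.
  by apply: cvgD; apply: cvgM; [exact: cRe|exact: wr|exact: cIm|exact: wi].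
have [bnd unif] := compact_uniform cK crho.
have [_ uRe] := compact_uniform cK cRe; have [_ uIm] := compact_uniform cK cIm.
split=> // e e0; have e2 : 0 < e / 2 by rewrite divr_gt0.
have [d1 d10 h1] := unif e e0.
have [d2 d20 h2] := uRe (e / 2) e2; have [d3 d30 h3] := uIm (e / 2) e2.
exists (Num.min d1 (Num.min d2 d3)); first by rewrite !lt_min d10 d20.
move=> t t' Kt Kt'; rewrite !lt_min => /and3P[td1 td2 td3]; split; first exact: h1.
rewrite (le_trans (cnorm_le_ReIm _))// cReB cImB.
by have := h2 _ _ Kt Kt' td2; have := h3 _ _ Kt Kt' td3; lra.
Qed.

Lemma half_exp_le1 n : x_ n <= 1.
Proof. by rewrite exprn_ile1//; lra. Qed.

Lemma staged_sequence (K : nat -> set R) (phi : R -> R) (lam : R -> R[i]) :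
  (forall n, compact (K n)) -> (forall n t, K n t -> 0 <= t < pi *+ 2) ->
  (forall n t, K n t -> cnorm (lam t) = 1) ->
  (forall n, [/\ {within K n, continuous phi},
     {within K n, continuous (fun t => Re (lam t))} &
     {within K n, continuous (fun t => Im (lam t))}]) ->
  exists (S : nat -> R[i] -> R[i]) (G : nat -> set R) (tau : nat -> R),
  [/\ forall n, 0 <= tau n <= x_ n,
      forall n z, cnorm z <= 1 -> hol (S n) z,
      forall n, cnorm (S n.+1 0 - S n 0) <= x_ n /\ forall z u,
        cnorm z <= 1 - x_ n -> cnorm u <= 1 - x_ n ->
        cnorm ((S n.+1 z - S n z) - (S n.+1 u - S n u)) <= x_ n * cnorm (z - u),
      forall n, measurable (G n) /\ (mu (G n) <= (x_ n)%:E)%E &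
      forall n t, K n t -> ~ G n t ->
        `|phi t - Re (conjc (lam t) * S n.+1 (expi t))| <= tau n.+1 /\
        (`|phi t - Re (conjc (lam t) * S n (expi t))| <= tau n ->
         forall z, cnorm z <= 1 -> cnorm (z - expi t) <= n.+1%:R * (1 - cnorm z ^+ 2) ->
         cnorm (S n.+1 z - S n z) <= x_ n)].
Proof.
move=> cK K2pi lam1 cont.
(* With [eps = x_n], [k0 = a * x_n^2], [n0 = 16 / x_n] and [tau n = b * x_n^3] the powers of [x_n]
   cancel in the last two conditions of [stage]. They become [16 * 32^2 * a <= 1 / 32] and
   [8 * b / a <= 1 / 2], both equalities here. The first condition is [2 * pi < 8]. *)
pose a : R := 1 / (32 * 32 * 32 * 16); have a0 : 0 < a by rewrite divr_gt0 ?mulr_gt0.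
pose b : R := a / 16; have b0 : 0 < b by rewrite divr_gt0.
pose tau n := b * x_ n ^+ 3.
(* Holomorphy of the current sum is a premise inside the existential, so that choice yields a total
   successor function; the premise is recovered by induction in [hS]. *)
have step (nS : nat * (R[i] -> R[i])) : exists fG : (R[i] -> R[i]) * set R,
  (forall z, cnorm z <= 1 -> hol nS.2 z) ->
  [/\ forall z, cnorm z <= 1 -> hol fG.1 z,
      cnorm (fG.1 0) <= x_ nS.1 /\ forall z u,
        cnorm z <= 1 - x_ nS.1 -> cnorm u <= 1 - x_ nS.1 ->
        cnorm (fG.1 z - fG.1 u) <= x_ nS.1 * cnorm (z - u),
      measurable fG.2 /\ (mu fG.2 <= (x_ nS.1)%:E)%E,
      forall t, K nS.1 t -> ~ fG.2 t ->
        `|phi t - Re (conjc (lam t) * nS.2 (expi t)) -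
          Re (conjc (lam t) * fG.1 (expi t))| <= tau nS.1.+1 &
      forall t z, K nS.1 t -> ~ fG.2 t ->
        `|phi t - Re (conjc (lam t) * nS.2 (expi t))| <= tau nS.1 -> cnorm z <= 1 ->
        cnorm (z - expi t) <= nS.1.+1%:R * (1 - cnorm z ^+ 2) ->
        cnorm (fG.1 z) <= x_ nS.1].
  case: nS => n S /=.
  have [hS|nS] := pselect (forall z, cnorm z <= 1 -> hol S z); last first.
    by exists (S, set0) => /nS.
  have [c1 c2 c3] := cont n; have [cr ci] := continuous_hol_expi hS.
  have [[C hC] unif] := residual_uniform (cK n) c1 c2 c3 cr ci.
  have xn0 := half_exp_gt0 R n; have xn1 := half_exp_le1 n.
  pose n0 := (16 * 2 ^ n)%N.
  have n0x : n0%:R * x_ n = 16.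
    by rewrite natrM natrX -mulrA -exprMn mulrC (_ : 2 * (1 / 2) = 1) ?expr1n ?mul1r//; lra.
  have n0E : n0%:R = 16 / x_ n by rewrite -n0x mulfK// gt_eqF.
  have r01 : 0 <= 1 - x_ n < 1 by apply/andP; split; lra.
  have tau0 m : 0 < tau m by rewrite /tau; have := half_exp_gt0 R m => h; pos.
  have k00 : 0 < a * x_ n ^+ 2 by pos.
  have n10 : 0 < n.+1%:R :> R by rewrite ltr0n.
  have := @stage R (K n) _ lam C (x_ n) (tau n) (tau n.+1) (a * x_ n ^+ 2) n.+1%:R (1 - x_ n) n0
    (K2pi n) (lam1 n) hC unif xn0 (tau0 n) (tau0 n.+1) k00 n10 r01.
  case.
  - have -> : pi *+ 2 = pi + pi :> R by [].
    by rewrite mulrA n0x; have := pihalf_lt2 R; lra.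
  - rewrite n0E (_ : a * x_ n ^+ 2 * (4 * (16 / x_ n)) = 64 * a * x_ n).
      have : a * x_ n <= a * 1 by rewrite ler_pM2l.
      by rewrite /a; lra.
    by field; rewrite gt_eqF.
  - rewrite n0E /tau [x_ n.+1]exprS.
    rewrite (_ : 16 * (a * x_ n ^+ 2 * (b * x_ n ^+ 3)) * (2 * (16 / x_ n)) ^+ 2 =
      16 * 32 * 32 * a * (b * x_ n ^+ 3)); last by field; rewrite gt_eqF.
    rewrite (_ : b * (1 / 2 * x_ n) ^+ 3 / 4 = 1 / 32 * (b * x_ n ^+ 3)); last by field.
    by rewrite ler_pM2r ?mulr_gt0 ?exprn_gt0// /a; lra.
  - rewrite /tau /b (_ : 8 * (a / 16 * x_ n ^+ 3) / (a * x_ n ^+ 2) = x_ n / 2)//.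
    by field; rewrite !gt_eqF.
  move=> f [G [h1 h2 h3 h4 h5]].
  exists (f, G) => _; split; [exact: h1|exact: h2|exact: h3|exact: h4|exact: h5].
have [st hst] := choice step.
pose S := fix S n := if n is m.+1 then (fun z => S m z + (st (m, S m)).1 z) else (fun=> 0 : R[i]).
have hS n : forall z, cnorm z <= 1 -> hol (S n) z.
  elim: n => [|n IH] z z1; first exact: hol_cst.
  have [h1 _ _ _ _] := hst (n, S n) IH.
  by apply: holD; [exact: IH|exact: h1].
have SD n z : S n.+1 z - S n z = (st (n, S n)).1 z by rewrite /= addrC addKr.
exists S, (fun n => (st (n, S n)).2), tau; split => //.
- move=> n; have x0 := half_exp_gt0 R n; have x1 := half_exp_le1 n.
  have t0 : 0 <= tau n by apply: mulr_ge0; [exact: ltW|apply: exprn_ge0; exact: ltW].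
  rewrite t0 /=.
  have h : x_ n ^+ 3 <= x_ n by rewrite exprS ler_piMr ?(ltW x0)// exprn_ile1// ltW.
  have b1 : b <= 1 by rewrite /b /a; lra.
  by apply: le_trans h; rewrite /tau ler_piMl// exprn_ge0// ltW.
- by move=> n; have [_ h _ _ _] := hst (n, S n) (hS n); split => [|z u]; rewrite !SD; apply h.
- by move=> n; have [_ _ h _ _] := hst (n, S n) (hS n).
- move=> n t Kt nG; have [_ _ _ h4 h5] := hst (n, S n) (hS n).
  split; last by move=> ht z z1 hz; rewrite SD; exact: (h5 t z).
  have := h4 t Kt nG; rewrite /= mulrDr cReD opprD addrA.
  exact.
Qed.

(** From some stage on the increments are small on the whole Stolz domain, so the tail is small
    along the path. What remains is one fixed [S n], which is continuous at the vertex and has a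
    small residual there. *)
Lemma boundary_limit (S : nat -> R[i] -> R[i]) (tau : nat -> R) (phi t : R) (lam : R[i]) N
    (g : R -> R[i]) : cnorm lam = 1 ->
  (forall n, 0 <= tau n <= x_ n) ->
  (forall n z, cnorm z <= 1 -> hol (S n) z) ->
  (forall n, (N <= n)%N ->
     `|phi - Re (conjc lam * S n.+1 (expi t))| <= tau n.+1 /\
     (`|phi - Re (conjc lam * S n (expi t))| <= tau n ->
      forall z, cnorm z <= 1 -> cnorm (z - expi t) <= n.+1%:R * (1 - cnorm z ^+ 2) ->
      cnorm (S n.+1 z - S n z) <= x_ n)) ->
  nontangential_path (expi t) g ->
  Re (conjc lam * climit (fun n => S n (g s))) @[s --> 1^'-] --> phi.
Proof.
move=> lam1 htau hS hN [_ [g1 [glim [theta [th2 [s0 [s01 hs0]]]]]]].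
have e1 : cnorm (expi t) = 1 by exact: cnorm_expi.
pose A := 1 + tan theta.
(* [N.+1] because stage [n] controls the residual of [S n.+1]; the other bound makes the growing
   aperture exceed that of the path. *)
pose M := maxn N.+1 (Num.bound A).
have res n : (M <= n)%N -> `|phi - Re (conjc lam * S n (expi t))| <= tau n.
  rewrite geq_max => /andP[Nn _]; case: n Nn => // n; rewrite ltnS => Nn.
  by have [] := hN n Nn.
apply/cvgrPdist_lt => e e0.
have e16 : 0 < e / 16 by rewrite divr_gt0.
have [k hk] := half_exp_small e16.
pose n := maxn M k.
have Mn : (M <= n)%N by exact: leq_maxl.
have xn : x_ n <= e / 16 by rewrite (le_trans (half_exp_le R (leq_maxr M k))).
have e1' : cnorm (expi t) <= 1 by rewrite e1.
have e40 : 0 < e / 4 by rewrite divr_gt0.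
have [d d0 hd] := hol_cont (hS n _ e1') e40.
have gd (r : R) : 0 < r -> \forall s \near 1^'-, cnorm (g s - expi t) < r.
  by move=> r0; move/cvg_complexP: glim => /(_ r r0).
(* The sign of [A] becomes known only through [stolz_of_arg], so the radius is taken with
   [Num.max A 1]. *)
have A0 : 0 < Num.max A 1 by rewrite lt_max ltr01 orbT.
near=> s.
have s1 : s < 1 by near: s; exact: nbhs_left_lt.
have s00 : 0 <= s.
  by apply: ltW; near: s; apply: nbhs_left_gt.
have ss0 : s0 <= s by apply: ltW; near: s; apply: nbhs_left_gt.
have gs1 : cnorm (g s) < 1.
  by have := g1 s; rewrite s00 s1 normE ltcR => /(_ isT).
have gsd : cnorm (g s - expi t) < d by near: s; exact: gd.
have gsA : cnorm (g s - expi t) < 1 / Num.max A 1.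
  by near: s; apply: gd; rewrite divr_gt0.
have [hre harg] := hs0 s (introT andP (conj ss0 s1)).
have [Apos hst] : 0 < A /\ cnorm (g s - expi t) <= A * (1 - cnorm (g s) ^+ 2).
  apply: stolz_of_arg => //.
  have [A1|A1] := leP A 0.
    by rewrite (le_trans _ ler01)// mulr_ge0_le0 ?cnorm_ge0.
  move: gsA; rewrite ltr_pdivlMr// => /ltW; apply: le_trans.
  by rewrite ler_wpM2l ?cnorm_ge0// le_max lexx.
have An m : (M <= m)%N -> cnorm (g s - expi t) <= m.+1%:R * (1 - cnorm (g s) ^+ 2).
  move=> Mm; apply: (le_trans hst); rewrite ler_wpM2r ?le_unit_sub_sqr ?(ltW gs1)//.
  apply: ltW; apply: (lt_le_trans (archi_boundP (ltW Apos))).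
  by rewrite ler_nat (leq_trans _ (leqW Mm))// leq_maxr.
have inc m : (M <= m)%N -> cnorm (S m.+1 (g s) - S m (g s)) <= 1 * x_ m.
  move=> Mm; rewrite mul1r; have Nm : (N <= m)%N.
    by rewrite (leq_trans _ Mm)// leq_max leqnSn.
  by have [_] := hN m Nm; apply; [exact: res|exact: ltW|exact: An].
have hf := climit_geometric ler01 inc Mn.
have hr := res n Mn; have /andP[_ ht] := htau n.
have hc := hd _ gsd.
set fz := climit _ in hf *.
(* The residual at the vertex, the continuity of [S n] there and the tail along the path contribute
   at most [e / 16], [e / 4] and [e / 4]. *)
have -> : phi - Re (conjc lam * fz) = (phi - Re (conjc lam * S n (expi t))) -
    Re (conjc lam * (S n (g s) - S n (expi t))) - Re (conjc lam * (fz - S n (g s))).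
  by rewrite !mulrBr !cReB; ring.
have b1 : `|Re (conjc lam * (S n (g s) - S n (expi t)))| < e / 4.
  by rewrite (le_lt_trans (normr_Re _))// cnormM cnorm_conj lam1 mul1r.
have b2 : `|Re (conjc lam * (fz - S n (g s)))| <= 4 * 1 * x_ n.
  by rewrite (le_trans (normr_Re _))// cnormM cnorm_conj lam1 mul1r.
have t1 := ler_normB (phi - Re (conjc lam * S n (expi t)) -
    Re (conjc lam * (S n (g s) - S n (expi t)))) (Re (conjc lam * (fz - S n (g s)))).
have t2 := ler_normB (phi - Re (conjc lam * S n (expi t)))
    (Re (conjc lam * (S n (g s) - S n (expi t)))).
by move: t1 t2 b1 b2 hr ht xn e0; clear; lra.
Unshelve. all: by end_near.
Qed.

(** A disc of radius [r < 1] lies in all but finitely many of the discs [|z| <= 1 - x_n]; there the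
    value at 0 and the Lipschitz bound make each increment at most [2 * x_n]. *)
Lemma analytic_limit (S : nat -> R[i] -> R[i]) :
  (forall n z, cnorm z <= 1 -> hol (S n) z) ->
  (forall n, cnorm (S n.+1 0 - S n 0) <= x_ n /\ forall z u,
     cnorm z <= 1 - x_ n -> cnorm u <= 1 - x_ n ->
     cnorm ((S n.+1 z - S n z) - (S n.+1 u - S n u)) <= x_ n * cnorm (z - u)) ->
  forall z, cnorm z < 1 -> hol (fun u => climit (fun n => S n u)) z.
Proof.
move=> hS hL z z1.
pose r := (1 + cnorm z) / 2.
have zr : cnorm z < r by rewrite /r; lra.
have r1 : 0 < 1 - r by rewrite /r; lra.
have r0 : 0 <= r by rewrite /r; have := cnorm_ge0 z; lra.
have [M hM] := half_exp_small r1.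
have rn n : (M <= n)%N -> r <= 1 - x_ n.
  by move=> Mn; have := half_exp_le R Mn; lra.
apply: (hol_climit (r := r) (M := M)) => //.
- by move=> n; apply: hS; exact: ltW.
- move=> n u Mn ur; exists 2 => // m nm.
  have rm := rn m (leq_trans Mn nm).
  have [h0 hl] := hL m.
  have u0 : cnorm (0 : R[i]) <= 1 - x_ m by rewrite cnorm0; lra.
  have := hl u 0 (le_trans ur rm) u0; rewrite subr0 => h.
  have h1 := cdistB (S m.+1 u - S m u) (S m.+1 0 - S m 0).
  have xm := half_exp_gt0 R m.
  have h2 : x_ m * cnorm u <= x_ m * 1 by rewrite ler_pM2l//; lra.
  by move: h h1 h0 h2; clear; lra.
- move=> n u v Mn ur vr; have [_ hl] := hL n.
  by apply: hl; rewrite (le_trans _ (rn n Mn)).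
Qed.

Lemma null_setU (A B : set R) : measurable A -> measurable B ->
  mu A = 0 -> mu B = 0 -> mu (A `|` B) = 0.
Proof.
move=> mA mB A0 B0; apply/eqP; rewrite eq_le measure_ge0 andbT.
have hA : (mu A <= 0)%E by rewrite A0.
have hB : (mu B <= 0)%E by rewrite B0.
apply: (le_trans (measureU2 _ _ _)); [exact: mA|exact: mB|].
by apply: le_trans (leeD hA hB) _; rewrite adde0.
Qed.

Lemma null_lim_sup (F : nat -> set R) (c : R) : 0 <= c -> (forall n, measurable (F n)) ->
  (forall n, (mu (F n) <= (c * x_ n)%:E)%E) -> mu (lim_sup_set F) = 0.
Proof.
move=> c0 mF hF; apply: lim_sup_set_cvg0 => //.
have c20 : 0 <= 2 * c by rewrite mulr_ge0.
(* [c * x_n] is written as [2 * c / 2^(n+1)], the summand of [epsilon_trick0]. *)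
apply: (@le_lt_trans _ _ (\sum_(0 <= n <oo) ((2 * c) / (2 ^ n.+1)%:R)%:E)%E).
  apply: lee_nneseries; first by move=> *; exact: measure_ge0.
  move=> n *.
  rewrite (le_trans (hF n))// lee_fin natrX expr_div_n expr1n exprS.
  by rewrite le_eqVlt; apply/orP; left; apply/eqP; field; rewrite expf_neq0.
exact: le_lt_trans (epsilon_trick0 xpredT c20) (ltry _).
Qed.

End Assembly.

(** * Convergence outside a Borel-Cantelli null set *)

Theorem theorem2p1 (R : realType) (lam : R[i] -> R[i]) (phi : R[i] -> R) :
  (forall zeta : R[i], `|zeta| = 1 -> `|lam zeta| = 1) ->
  circle_measurable_complex lam ->
  circle_measurable_real phi ->
  exists f : R[i] -> R[i],
    analytic_on_disc f /\
    {ae (@lebesgue_measure R), forall t : R, t \in `[0, pi *+ 2[ ->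
       forall g : R -> R[i], nontangential_path (expi t) g ->
         complex.Re ((lam (expi t))^* * f (g s)) @[s --> 1^'-]
           --> phi (expi t)}.
Proof.
move=> lam1 [mlr mli] mphi; pose mu := @lebesgue_measure R.
have lam1' t : cnorm (lam (expi t)) = 1.
  have := lam1 (expi t); rewrite !normE cnorm_expi => /(_ erefl).
  by move/(congr1 (@complex.Re R)).
pose D := `[0, pi *+ 2[%classic : set R.
have mD : measurable D by exact: measurable_itv.
have [Z1 [mZ1 Z10 h1]] := borel_reduction mD mphi.
have [Z2 [mZ2 Z20 h2]] := borel_reduction mD mlr.
have [Z3 [mZ3 Z30 h3]] := borel_reduction mD mli.
pose Z := Z1 `|` Z2 `|` Z3.
have mZ : measurable Z by apply: measurableU => //; exact: measurableU.
have mZ12 : measurable (Z1 `|` Z2) by exact: measurableU.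
have Z0 : mu Z = 0 := null_setU mZ12 mZ3 (null_setU mZ1 mZ2 Z10 Z20) Z30.
pose D' := D `\` Z.
have mD' : measurable D' by exact: measurableD.
have D'fin : (mu D' < +oo)%E.
  apply: (@le_lt_trans _ _ (mu D)).
    by apply: le_measure; rewrite ?inE// => t [].
  rewrite /D /mu lebesgue_measure_itv /=; case: ifP => _; last exact: ltry.
  by rewrite -EFinB ltry.
have sub (Zi : set R) (u : R -> R) : measurable Zi -> Zi `<=` Z ->
    measurable_fun (D `\` Zi) u -> measurable_fun D' u.
  move=> mZi ZiZ; apply: measurable_funS; first exact: measurableD.
  by move=> t [Dt Zt]; split => // /ZiZ.
have {}h1 := sub _ _ mZ1 (fun t h => or_introl (or_introl h)) h1.
have {}h2 := sub _ _ mZ2 (fun t h => or_introl (or_intror h)) h2.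
have {}h3 := sub _ _ mZ3 (fun t h => or_intror h) h3.
have [K hK] := choice (fun n => lusin3 mD' D'fin (half_exp_gt0 R n) h1 h2 h3).
have KD n : K n `<=` D' by have [] := hK n.
have K2pi n t : K n t -> 0 <= t < pi *+ 2.
  by move=> /KD[]; rewrite /D /= in_itv.
have [S [G [tau [htau hS hinc hG hbdy]]]] := @staged_sequence R K (fun t => phi (expi t))
  (fun t => lam (expi t)) (fun n => (and5_rec (fun a _ _ _ _ => a) (hK n))) K2pi
  (fun n t _ => lam1' t) (fun n => (and5_rec (fun _ _ _ _ a => a) (hK n))).
(* A point is bad at stage [n] if the Lusin set misses it or the stage excludes it; the measures, at
   most [2 * x_n], are summable. *)
pose B n := (D' `\` K n) `|` G n.
have mK n : measurable (K n) by have [] := hK n.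
have mB n : measurable (B n).
  by apply: measurableU; [exact: measurableD|have [] := hG n].
have muB n : (mu (B n) <= (2 * (1 / 2) ^+ n)%:E)%E.
  have [mGn hGn] := hG n; have [_ _ _ hKn _] := hK n.
  apply: (le_trans (measureU2 _ _ _)); [by apply: measurableD => //; exact: mK|exact: mGn|].
  rewrite (_ : 2 * (1 / 2) ^+ n = (1 / 2) ^+ n + (1 / 2) ^+ n); last by ring.
  by rewrite EFinD; exact: leeD.
have mL : measurable (lim_sup_set B).
  by apply: bigcapT_measurable => n; apply: bigcup_measurable => k _; exact: mB.
exists (fun z => climit (fun n => S n z)); split.
  move=> z; rewrite normE ltcR => z1.
  exact: (analytic_limit hS hinc z1).
exists (Z `|` lim_sup_set B); split.
- exact: measurableU.
- by apply: null_setU => //; exact: (null_lim_sup (c := 2)).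
move=> t /= ht; apply: contrapT => nt; apply: ht.
rewrite in_itv/= => tD g hg.
have Zt : ~ Z t by move=> h; apply: nt; left.
have Bt : ~ lim_sup_set B t by move=> h; apply: nt; right.
have [N hN] : exists N, forall n, (N <= n)%N -> ~ B n t.
  apply: contrapT => H; apply: Bt => n _; apply: contrapT => H2; apply: H.
  by exists n => m nm Bm; apply: H2; exists m.
have D't : D' t by split => //; rewrite /D /= in_itv.
apply: (boundary_limit (N := N) (lam1' t) htau hS _ hg) => n Nn.
apply: hbdy; last by move=> Gt; apply: (hN n Nn); right.
by apply: contrapT => Kt; apply: (hN n Nn); left.
Qed.
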